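(* Let $n\ge 1$ be an integer and let $p,q\in[1,\infty]$. Suppose that for some real numbers $\alpha\ge 0$ and $s\ge 0$ there is a constant $K<\infty$ such that for every Schwartz function $\Gamma_0:\mathbb R^n\times\mathbb R^n\to\mathbb C$, with $\Gamma(t,x,y)=e^{\frac{it(\Delta_x-\Delta_y)}{2}}\Gamma_0(x,y)$ for $t\in\mathbb R$ and $x,y\in\mathbb R^n$, one has $$\big\|\,|\nabla|_x^{\alpha}\big(\Gamma(t,x,x)\big)\big\|_{L^p(dt)L^q(dx)}\le K\,\|\Gamma_0\|_{H^s(dx\,dy)}.$$ Then $p\ge 2$ and $q\ge 2$.
   Context: The function $\Gamma(t,\cdot,\cdot)=e^{\frac{it(\Delta_x-\Delta_y)}{2}}\Gamma_0$ is the function on $\mathbb R^{n}\times\mathbb R^n$ whose Fourier transform in $(x,y)$, with dual variables $(\xi,\eta)$ and the convention in which $\nabla_x$ corresponds to multiplication by $i\xi$ and $\nabla_y$ to multiplication by $i\eta$, is $e^{-\frac{it(|\xi|^2-|\eta|^2)}{2}}\widehat{\Gamma_0}(\xi,\eta)$. For each $t$, $\Gamma(t,x,x)$ denotes the restriction to the diagonal, a function of $x\in\mathbb R^n$, and $|\nabla|_x^{\alpha}$ is the Fourier multiplier on $\mathbb R^n$ with symbol $|\xi|^{\alpha}$, applied to the function $x\mapsto\Gamma(t,x,x)$. The mixed norm is $\|f\|_{L^p(dt)L^q(dx)}=\big\|\,\|f(t,\cdot)\|_{L^q(\mathbb R^n)}\big\|_{L^p(\mathbb R)}$ (with values in $[0,\infty]$),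 where $t$ ranges over all of $\mathbb R$. $H^s(dx\,dy)$ is the inhomogeneous $L^2$-based Sobolev space on $\mathbb R^{2n}$. *)

(* Defs.v *)
From HB Require Import structures.
From mathcomp Require Import all_boot all_order all_algebra.
From mathcomp Require Import complex.
From mathcomp Require Import all_classical all_reals all_analysis.

Set Implicit Arguments.
Unset Strict Implicit.
Unset Printing Implicit Defensive.

Import Order.TTheory GRing.Theory Num.Theory.
Import numFieldNormedType.Exports.

Local Open Scope classical_set_scope.
Local Open Scope ring_scope.

(* R^d is 'rV[R]_d, and R^n x R^n is identified with 'rV[R]_(n + n).  The
   library norm `|x| on 'rV[R]_d is the sup norm; |x| below always means the
   Euclidean norm [enorm]. *)

Definition rV_display : measure_display.
Proof. exact: (measure_tuple_display default_measure_display). Qed.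

Section measurable_rV.
Context {R : realType} (d : nat).

Let coords (i : 'I_d) (x : 'rV[R]_d) : measurableTypeR R := x 0 i.

Let rV_set0 : g_sigma_preimage coords set0.
Proof. exact: sigma_algebra0. Qed.

Let rV_setC A : g_sigma_preimage coords A -> g_sigma_preimage coords (~` A).
Proof. exact: sigma_algebraC. Qed.

Let rV_bigcup (F : (set 'rV[R]_d)^nat) :
  (forall i, g_sigma_preimage coords (F i)) ->
  g_sigma_preimage coords (\bigcup_i (F i)).
Proof. exact: sigma_algebra_bigcup. Qed.

(* The sigma-algebra generated by the coordinate maps, i.e. the Borel one. *)
HB.instance Definition _ := @isMeasurable.Build rV_display
  'rV[R]_d (g_sigma_preimage coords) rV_set0 rV_setC rV_bigcup.

Lemma measurable_coord (i : 'I_d) :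
  measurable_fun [set: 'rV[R]_d] (fun x => x 0 i : measurableTypeR R).
Proof.
move=> _ Y mY; rewrite setTI; apply: sub_sigma_algebra => /=.
rewrite -bigcup_seq/=; exists i => /=; first by rewrite mem_index_enum.
by exists Y => //; rewrite setTI.
Qed.

Lemma measurable_fun_coordP d' (T : measurableType d') (f : T -> 'rV[R]_d) :
  (forall i, measurable_fun [set: T] (fun x => f x 0 i : measurableTypeR R)) ->
  measurable_fun [set: T] f.
Proof.
move=> mf.
apply: (@measurability _ _ _ _ _ _
  (\big[setU/set0]_(i < d) preimage_set_system setT (coords i) measurable)) => //.
move=> _ [B + <-]; rewrite -bigcup_seq => -[i _ [A mA <-]].
by rewrite !setTI; have := mf i measurableT A mA; rewrite setTI.
Qed.

End measurable_rV.

Section lebesgue_rV.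
Context {R : realType}.

Definition rV_cons (d : nat) (u : measurableTypeR R * 'rV[R]_d) : 'rV[R]_d.+1 :=
  \row_(i < d.+1) (if unlift ord0 i is Some j then u.2 0 j else u.1).

Definition rV_uncons (d : nat) (x : 'rV[R]_d.+1) : measurableTypeR R * 'rV[R]_d :=
  (x 0 ord0, \row_(j < d) x 0 (lift ord0 j)).

Lemma rV_consK d : cancel (@rV_cons d) (@rV_uncons d).
Proof.
move=> [a x]; rewrite /rV_uncons /rV_cons mxE unlift_none /=; congr pair.
by apply/rowP => j; rewrite !mxE liftK.
Qed.

Lemma rV_unconsK d : cancel (@rV_uncons d) (@rV_cons d).
Proof.
move=> x; apply/rowP => i; rewrite mxE.
by case: unliftP => [j|] -> //=; rewrite mxE.
Qed.

Lemma measurable_rV_cons d : measurable_fun setT (@rV_cons d).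
Proof.
apply: measurable_fun_coordP => i; rewrite /rV_cons.
under eq_fun do rewrite mxE.
case: (unlift ord0 i) => [j|]; last exact: measurable_fst.
exact: (measurableT_comp (measurable_coord j) measurable_snd).
Qed.

Lemma measurable_rV_uncons d : measurable_fun setT (@rV_uncons d).
Proof.
apply/measurable_fun_pairP; split; first exact: (measurable_coord ord0).
apply: measurable_fun_coordP => i; rewrite /rV_uncons /comp /=.
by under eq_fun do rewrite mxE; exact: measurable_coord.
Qed.

Section step.
Variables (d : nat) (mu : {sigma_finite_measure set 'rV[R]_d -> \bar R}).

Definition lebesgue_rV_step : set 'rV[R]_d.+1 -> \bar R :=
  pushforward (lebesgue_measure \x mu)%E (@rV_cons d).

Let step0 : lebesgue_rV_step set0 = 0%E.
Proof. by rewrite /lebesgue_rV_step /pushforward preimage_set0 measure0. Qed.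

Let step_ge0 A : (0 <= lebesgue_rV_step A)%E.
Proof. by rewrite /lebesgue_rV_step /pushforward; exact: measure_ge0. Qed.

Let step_sigma_additive : semi_sigma_additive lebesgue_rV_step.
Proof.
exact: (@measure_semi_sigma_additive _ _ _
  (measure_function_pushforward__canonical__measure_function_Measure
    (lebesgue_measure \x mu)%E (@measurable_rV_cons d))).
Qed.

HB.instance Definition _ := isMeasure.Build _ _ _ lebesgue_rV_step
  step0 step_ge0 step_sigma_additive.

Let step_sigma_finite : sigma_finite setT lebesgue_rV_step.
Proof.
have /sigma_finiteP[F [TF ndF Foo]] := sigma_finiteT (@lebesgue_measure R).
have /sigma_finiteP[G [TG ndG Goo]] := sigma_finiteT mu.
exists (fun k => @rV_uncons d @^-1` (F k `*` G k)).
  apply/esym; rewrite -subTset => x _.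
  have [i _ Fi] : (\bigcup_i F i) (rV_uncons x).1 by rewrite -TF.
  have [j _ Gj] : (\bigcup_i G i) (rV_uncons x).2 by rewrite -TG.
  exists (maxn i j) => //; split.
  - by move: Fi; exact/subsetPset/ndF/leq_maxl.
  - by move: Gj; exact/subsetPset/ndG/leq_maxr.
move=> k; have [? ?] := Foo k; have [? ?] := Goo k; split.
  by rewrite -[X in measurable X]setTI; apply: measurable_rV_uncons => //;
    exact: measurableX.
rewrite /lebesgue_rV_step /pushforward -comp_preimage.
rewrite (_ : _ \o _ = id); last by apply/funext => u /=; exact: rV_consK.
by rewrite preimage_id product_measure1E // lte_mul_pinfty // ge0_fin_numE.
Qed.

HB.instance Definition _ := Measure_isSigmaFinite.Build _ _ _ lebesgue_rV_step
  step_sigma_finite.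

End step.

(* Lebesgue measure on R^d, as the d-fold product of [lebesgue_measure]. *)
Fixpoint lebesgue_rV (d : nat) : {sigma_finite_measure set 'rV[R]_d -> \bar R} :=
  match d with
  | 0 => \d_(0 : 'rV[R]_0)
  | d'.+1 => lebesgue_rV_step (lebesgue_rV d')
  end.

Lemma lebesgue_rV_box d (A : 'I_d -> set (measurableTypeR R)) :
  (forall i, measurable (A i)) ->
  lebesgue_rV d [set x | forall i, A i (x 0 i)] =
  (\prod_(i < d) lebesgue_measure (A i))%E.
Proof.
elim: d A => [|d IH] A mA.
  by rewrite big_ord0 /= diracE mem_set //= => -[].
have mB : measurable [set x : 'rV[R]_d | forall i, A (lift ord0 i) (x 0 i)].
  rewrite [X in measurable X](_ : _ = \bigcap_(i in [set: 'I_d])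
      ((fun x : 'rV[R]_d => x 0 i : measurableTypeR R) @^-1` A (lift ord0 i))).
    apply: fin_bigcap_measurable => // i _.
    by rewrite -[X in measurable X]setTI; exact: measurable_coord.
  by apply/seteqP; split=> x /= Ax i; [move=> _; exact: Ax | exact: (Ax i I)].
rewrite big_ord_recl -IH // -product_measure1E //.
congr (product_measure1 _ _ _); apply/seteqP; split=> [[a x]|[a x] [Aa Ax]] /=.
  move=> Aax; split=> /= [|i]; first by move: (Aax ord0); rewrite mxE unlift_none.
  by move: (Aax (lift ord0 i)); rewrite mxE liftK.
by move=> i; rewrite mxE; case: unliftP => [j|] ->.
Qed.

End lebesgue_rV.

Section fourier.
Context {R : realType}.

Definition dot (d : nat) (x y : 'rV[R]_d) : R := \sum_(i < d) x 0 i * y 0 i.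

Definition enorm (d : nat) (x : 'rV[R]_d) : R := Num.sqrt (dot x x).

(* The modulus as an element of R; `|z| is an element of R[i]. *)
Definition cmod (z : R[i]) : R := Normc.normc z.

(* e^(i theta) *)
Definition cexpi (theta : R) : R[i] := Complex (cos theta) (sin theta).

Definition cintegral (d : nat) (f : 'rV[R]_d -> R[i]) : R[i] :=
  Complex (\int[lebesgue_rV d]_x complex.Re (f x))
          (\int[lebesgue_rV d]_x complex.Im (f x)).

(* The unitary normalization (2 pi)^(-d/2) is used for both transforms. *)
Definition fourier_cst (d : nat) : R := Num.sqrt (2 * pi) ^- d.

Definition fourier (d : nat) (f : 'rV[R]_d -> R[i]) (xi : 'rV[R]_d) : R[i] :=
  (fourier_cst d)%:C%C * cintegral (fun x => cexpi (- dot x xi) * f x).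

Definition inv_fourier (d : nat) (f : 'rV[R]_d -> R[i]) (x : 'rV[R]_d) : R[i] :=
  (fourier_cst d)%:C%C * cintegral (fun xi => cexpi (dot x xi) * f xi).

Definition fourier_multiplier (d : nat) (m f : 'rV[R]_d -> R[i]) :
    'rV[R]_d -> R[i] :=
  inv_fourier (fun xi => m xi * fourier f xi).

(* At xi = 0 the symbol is 0 `^ alpha, which is 1 if alpha = 0 and 0 otherwise. *)
Definition abs_nabla (d : nat) (alpha : R) : ('rV[R]_d -> R[i]) -> 'rV[R]_d -> R[i] :=
  fourier_multiplier (fun xi => (enorm xi `^ alpha)%:C%C).

Definition sobolev_norm (d : nat) (s : R) (f : 'rV[R]_d -> R[i]) : \bar R :=
  Lnorm (lebesgue_rV d) 2%:E (fun xi =>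
    ((1 + enorm xi ^+ 2) `^ (s / 2) * cmod (fourier f xi))%:E).

(* Iterated partial derivatives along the list of coordinates l, so that a
   multi-index corresponds to (at least) one list. *)
Definition partials (d : nat) (l : seq 'I_d) (f : 'rV[R]_d -> R) : 'rV[R]_d -> R :=
  foldr (fun i g => 'D_(delta_mx 0 i) g) f l.

(* 'D_v g x is a junk value where the derivative does not exist; smoothness is
   the differentiability of all the iterated partial derivatives. *)
Definition schwartzR (d : nat) (f : 'rV[R]_d -> R) : Prop :=
  forall l : seq 'I_d,
    (forall x, differentiable (partials l f) x) /\
    (forall k : nat, exists M : R, forall x,
       (1 + enorm x) ^+ k * `|partials l f x| <= M).

Definition schwartz (d : nat) (f : 'rV[R]_d -> R[i]) : Prop :=
  schwartzR (fun x => complex.Re (f x)) /\ schwartzR (fun x => complex.Im (f x)).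

(* F (x, y), as a function on R^(2n). *)
Definition on_prod (n : nat) (F : 'rV[R]_n -> 'rV[R]_n -> R[i]) :
    'rV[R]_(n + n) -> R[i] :=
  fun z => F (lsubmx z) (rsubmx z).

(* exp (i t (Laplacian_x - Laplacian_y) / 2) Gamma0; lsubmx zeta and rsubmx zeta
   are the dual variables of x and y. *)
Definition propagator (n : nat) (t : R) (Gamma0 : 'rV[R]_n -> 'rV[R]_n -> R[i]) :
    'rV[R]_n -> 'rV[R]_n -> R[i] :=
  fun x y => fourier_multiplier
    (fun zeta : 'rV[R]_(n + n) =>
       cexpi (- (t * (enorm (lsubmx zeta) ^+ 2 - enorm (rsubmx zeta) ^+ 2) / 2)))
    (on_prod Gamma0) (row_mx x y).

Definition mixed_norm (d : nat) (p q : \bar R) (f : R -> 'rV[R]_d -> R[i]) : \bar R :=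
  Lnorm (@lebesgue_measure R) p (fun t =>
    Lnorm (lebesgue_rV d) q (fun x => (cmod (f t x))%:E)).

End fourier.

(* Main.v *)
(* In the dual variables u = xi + eta and w = (xi - eta) / 2 the symbol
   |xi|^2 - |eta|^2 equals 2 u . w, so that the Fourier transform at u of
   x |-> Gamma(t,x,x) is, up to a constant, the integral over w of
   exp (- i t u . w) Gamma0^(u,w).  For
   Gamma0^ = exp (i tau w . (u - u0) - A |u - u0|^2 - |w|^2) this integral is an
   explicit positive Gaussian in u.
   Exponent p: with A = 1 and u0 = 0, superpose the N packets with
   tau = 0, N, ..., (N - 1) N.  The density is bounded below on a fixed box
   during a set of times of measure N, while almost orthogonality makes the
   squared H^s norm O(N); hence N^(1/p) <= M N^(1/2).
   Exponent q: with A = L^2, tau = 0 and u0 = (1, ..., 1), the density is of size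
   L^(-n) on a box of side comparable to L for t in [0, 1], while the H^s norm is
   O(L^(-n/2)); hence L^(n/q) <= M L^(n/2). *)
Require Import Defs.
From HB Require Import structures.
From mathcomp Require Import all_boot all_order all_algebra.
From mathcomp Require Import complex ring lra.
From mathcomp Require Import all_classical all_reals all_analysis measurable_realfun.

Set Implicit Arguments.
Unset Strict Implicit.
Unset Printing Implicit Defensive.

Import Order.TTheory GRing.Theory Num.Theory.
Import numFieldNormedType.Exports.

Local Open Scope classical_set_scope.
Local Open Scope ring_scope.

(** The lower bounds rest on positivity: the Fourier transform of the density is a sum of positive
    Gaussians and the factor |xi|^alpha keeps it nonnegative, so near x = 0 neither the packets nor
    the frequencies can cancel. Since cos y >= 1 - y^2 / 2, it suffices to bound the second moment
    of this transform by its mass. In the upper bounds Gaussian decay absorbs the weight (1 +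
    |zeta|^2)^s. Thus alpha and s affect only the constants. The time spacing N is dictated by weak
    decay: two packets whose parameters tau differ by T overlap by O(T^(-n)), only T^(-1) when n =
    1, and N^2 overlaps of size 1/N still add up to O(N). The centre (1, ..., 1) of the second
    family keeps |xi|^alpha bounded below while the Gaussian narrows; centred at 0 it would lose a
    factor L^(-alpha). [abs_nabla] applies the forward transform to a density that is computed as an
    inverse transform, so an inversion formula is unavoidable; explicit Gaussians make its
    elementary case sufficient. *)

Section dot.
Context {R : realType}.
Implicit Types (d m n : nat).

Lemma dotC d (x y : 'rV[R]_d) : dot x y = dot y x.
Proof. by apply: eq_bigr => i _; rewrite mulrC. Qed.

Lemma dotDl d (x y z : 'rV[R]_d) : dot (x + y) z = dot x z + dot y z.
Proof. by rewrite /dot -big_split; apply: eq_bigr => i _; rewrite mxE mulrDl. Qed.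

Lemma dotDr d (x y z : 'rV[R]_d) : dot z (x + y) = dot z x + dot z y.
Proof. by rewrite ![dot z _]dotC dotDl. Qed.

Lemma dotZl d a (x z : 'rV[R]_d) : dot (a *: x) z = a * dot x z.
Proof. by rewrite /dot mulr_sumr; apply: eq_bigr => i _; rewrite mxE mulrA. Qed.

Lemma dotZr d a (x z : 'rV[R]_d) : dot z (a *: x) = a * dot z x.
Proof. by rewrite ![dot z _]dotC dotZl. Qed.

Lemma dotNl d (x z : 'rV[R]_d) : dot (- x) z = - dot x z.
Proof. by rewrite -scaleN1r dotZl mulN1r. Qed.

Lemma dotNr d (x z : 'rV[R]_d) : dot z (- x) = - dot z x.
Proof. by rewrite ![dot z _]dotC dotNl. Qed.

Lemma dot0l d (z : 'rV[R]_d) : dot 0 z = 0.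
Proof. by rewrite -(scale0r 0) dotZl mul0r. Qed.

Lemma dot0r d (z : 'rV[R]_d) : dot z 0 = 0.
Proof. by rewrite dotC dot0l. Qed.

Definition dotE := (dotDl, dotDr, dotNl, dotNr, dotZl, dotZr).

Lemma dot_ge0 d (x : 'rV[R]_d) : 0 <= dot x x.
Proof. by apply: sumr_ge0 => i _; rewrite -expr2 sqr_ge0. Qed.

Lemma dot_row_mx m n (x x' : 'rV[R]_m) (y y' : 'rV[R]_n) :
  dot (row_mx x y) (row_mx x' y') = dot x x' + dot y y'.
Proof.
rewrite /dot big_split_ord; congr (_ + _); apply: eq_bigr => i _.
  by rewrite !row_mxEl.
by rewrite !row_mxEr.
Qed.

Lemma dot_rV_cons d (a b : R) (x y : 'rV[R]_d) :
  dot (rV_cons (a, x)) (rV_cons (b, y)) = a * b + dot x y.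
Proof.
rewrite /dot big_ord_recl !mxE unlift_none; congr (_ + _).
by apply: eq_bigr => i _; rewrite !mxE liftK.
Qed.

Lemma enormK d (x : 'rV[R]_d) : enorm x ^+ 2 = dot x x.
Proof. by rewrite sqr_sqrtr ?dot_ge0. Qed.

Lemma enorm_ge0 d (x : 'rV[R]_d) : 0 <= enorm x.
Proof. exact: sqrtr_ge0. Qed.

Lemma dot_sub_le d (x y : 'rV[R]_d) : dot (x - y) (x - y) <= 2 * dot x x + 2 * dot y y.
Proof.
have := dot_ge0 (x + y); rewrite !dotE (dotC y x); lra.
Qed.

Lemma dot_CS d (x y : 'rV[R]_d) : dot x y ^+ 2 <= dot x x * dot y y.
Proof.
have [y0|y0] := eqVneq (dot y y) 0.
  have h k := dot_ge0 (x + k *: y).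
  have {}h k : 0 <= dot x x + 2 * k * dot x y.
    by have := h k; rewrite !dotE (dotC y x) y0; lra.
  have [->|xy0] := eqVneq (dot x y) 0; first by rewrite y0; lra.
  (* With [dot y y = 0] the quadratic in [k] is affine; at this [k] it equals -1. *)
  have := h (- (dot x x + 1) / (2 * dot x y)).
  have -> : 2 * (- (dot x x + 1) / (2 * dot x y)) * dot x y = - (dot x x + 1).
    by field.
  lra.
have yp : 0 < dot y y by rewrite lt_def y0 dot_ge0.
pose q := dot x y / dot y y.
have xyE : dot x y = q * dot y y by rewrite mulfVK.
have := dot_ge0 (x - q *: y); rewrite !dotE (dotC y x) xyE => h.
have {}h : 0 <= (dot x x - q ^+ 2 * dot y y) * dot y y by rewrite mulr_ge0 ?dot_ge0//; lra.
by lra.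
Qed.

End dot.

(** * Measurability of vector and elementary operations *)

Section measurability.
Context {R : realType} d (T : measurableType d).

Lemma measurable_dot m (f g : T -> 'rV[R]_m) :
  measurable_fun setT f -> measurable_fun setT g ->
  measurable_fun setT (fun x => dot (f x) (g x)).
Proof.
move=> mf mg; apply: measurable_sum => i; apply: measurable_funM.
  exact: (measurableT_comp (measurable_coord i)).
exact: (measurableT_comp (measurable_coord i)).
Qed.

Lemma measurable_enorm m (f : T -> 'rV[R]_m) :
  measurable_fun setT f -> measurable_fun setT (fun x => enorm (f x)).
Proof.
move=> mf; apply: (measurableT_comp _ (measurable_dot mf mf)).
exact: continuous_measurable_fun (@sqrt_continuous R).
Qed.

Lemma measurable_vecD m (f g : T -> 'rV[R]_m) :
  measurable_fun setT f -> measurable_fun setT g ->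
  measurable_fun setT (fun x => f x + g x).
Proof.
move=> mf mg; apply: measurable_fun_coordP => i; under eq_fun do rewrite mxE.
by apply: measurable_funD; exact: (measurableT_comp (measurable_coord i)).
Qed.

Lemma measurable_vecZ m (a : R) (f : T -> 'rV[R]_m) :
  measurable_fun setT f -> measurable_fun setT (fun x => a *: f x).
Proof.
move=> mf; apply: measurable_fun_coordP => i; under eq_fun do rewrite mxE.
by apply: measurable_funM => //; exact: (measurableT_comp (measurable_coord i)).
Qed.

Lemma measurable_vecN m (f : T -> 'rV[R]_m) :
  measurable_fun setT f -> measurable_fun setT (fun x => - f x).
Proof.
by move=> mf; under eq_fun do rewrite -scaleN1r; exact: measurable_vecZ.
Qed.

Lemma measurable_row_mx m n (f : T -> 'rV[R]_m) (g : T -> 'rV[R]_n) :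
  measurable_fun setT f -> measurable_fun setT g ->
  measurable_fun setT (fun x => row_mx (f x) (g x)).
Proof.
move=> mf mg; apply: measurable_fun_coordP => i.
rewrite -(splitK i); case: (fintype.split i) => j /=.
  under eq_fun do rewrite row_mxEl.
  exact: (measurableT_comp (measurable_coord j)).
under eq_fun do rewrite row_mxEr.
exact: (measurableT_comp (measurable_coord j)).
Qed.

Lemma measurable_lsubmx m n (f : T -> 'rV[R]_(m + n)) :
  measurable_fun setT f -> measurable_fun setT (fun x => lsubmx (f x)).
Proof.
move=> mf; apply: measurable_fun_coordP => i; under eq_fun do rewrite mxE.
exact: (measurableT_comp (measurable_coord _)).
Qed.

Lemma measurable_rsubmx m n (f : T -> 'rV[R]_(m + n)) :
  measurable_fun setT f -> measurable_fun setT (fun x => rsubmx (f x)).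
Proof.
move=> mf; apply: measurable_fun_coordP => i; under eq_fun do rewrite mxE.
exact: (measurableT_comp (measurable_coord _)).
Qed.

Lemma measurable_expR_comp (f : T -> R) :
  measurable_fun setT f -> measurable_fun setT (fun x => expR (f x)).
Proof. by move=> mf; exact: (measurableT_comp (@measurable_expR R)). Qed.

Lemma measurable_cos_comp (f : T -> R) :
  measurable_fun setT f -> measurable_fun setT (fun x => cos (f x)).
Proof.
move=> mf; apply: (measurableT_comp _ mf).
exact: continuous_measurable_fun (@continuous_cos R).
Qed.

Lemma measurable_sin_comp (f : T -> R) :
  measurable_fun setT f -> measurable_fun setT (fun x => sin (f x)).
Proof.
move=> mf; apply: (measurableT_comp _ mf).
exact: continuous_measurable_fun (@continuous_sin R).
Qed.

End measurability.

(** * Integration on R^d *)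

Section fubini_rV.
Context {R : realType}.
Local Open Scope ereal_scope.

Lemma ge0_integral_rV_cons d (f : 'rV[R]_d.+1 -> \bar R) :
  measurable_fun setT f -> (forall x, 0 <= f x) ->
  \int[lebesgue_rV d.+1]_x f x =
  \int[lebesgue_measure]_a \int[lebesgue_rV d]_x f (rV_cons (a, x)).
Proof.
move=> mf f0.
rewrite [LHS](@ge0_integral_pushforward _ _ _ _ R _ (@measurable_rV_cons R d)
  (lebesgue_measure \x lebesgue_rV d) setT f)//.
rewrite preimage_setT fubini_tonelli1//; last by move=> x; exact: f0.
exact: (measurableT_comp mf (@measurable_rV_cons R d)).
Qed.

Lemma measurable_row_mx_pair m n :
  measurable_fun setT (fun p : 'rV[R]_m * 'rV[R]_n => row_mx p.1 p.2).
Proof. exact: measurable_row_mx. Qed.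

(** The type cast works because [m.+1 + n] computes to [(m + n).+1]. Both measures therefore peel
    off the same first coordinate, which drives the induction on [m] below. *)
Lemma row_mx_rV_cons m n a (x : 'rV[R]_m) (y : 'rV[R]_n) :
  row_mx (rV_cons (a, x)) y = rV_cons (a, row_mx x y) :> 'rV_(m + n).+1.
Proof.
apply/rowP => i; rewrite [RHS]mxE; case: (unliftP ord0 i) => [j|] ->{i} /=.
  case: (split_ordP j) => k ->.
    rewrite row_mxEl (_ : lift _ _ = lshift n (lift ord0 k)); last exact/val_inj.
    transitivity (rV_cons (a, x) 0%R (lift ord0 k)); last by rewrite mxE liftK.
    exact: (@row_mxEl R 1 m.+1 n).
  rewrite row_mxEr (_ : lift _ _ = rshift m.+1 k); last exact/val_inj.
  exact: (@row_mxEr R 1 m.+1 n).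
rewrite (_ : ord0 = lshift n ord0); last exact/val_inj.
transitivity (rV_cons (a, x) 0%R ord0); last by rewrite mxE unlift_none.
exact: (@row_mxEl R 1 m.+1 n).
Qed.

Lemma ge0_integral_row_mx m n (f : 'rV[R]_(m + n) -> \bar R) :
  measurable_fun setT f -> (forall x, 0 <= f x) ->
  \int[lebesgue_rV (m + n)]_z f z =
  \int[lebesgue_rV m]_x \int[lebesgue_rV n]_y f (row_mx x y).
Proof.
elim: m f => [|m IH] f mf f0.
  rewrite [RHS]integral_dirac//; last first.
    exact: (measurable_fun_fubini_tonelli_F (fun p => f (row_mx p.1 p.2))
       (measurableT_comp mf (@measurable_row_mx_pair 0 n))).
  rewrite diracT mul1e; apply: eq_integral => y _; congr f.
  apply/rowP => i; rewrite mxE; case: splitP => [[]//|k /= ik].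
  by congr (y _ _); exact/val_inj.
rewrite (ge0_integral_rV_cons mf)//.
rewrite ge0_integral_rV_cons//; last 2 first.
- exact: (measurable_fun_fubini_tonelli_F (fun p => f (row_mx p.1 p.2))
     (measurableT_comp mf (@measurable_row_mx_pair m.+1 n))).
- by move=> x; exact: integral_ge0.
apply: eq_integral => a _.
have mfa : measurable_fun setT (fun z => f (rV_cons (a, z))).
  apply: (measurableT_comp mf).
  exact: (measurableT_comp (@measurable_rV_cons R (m + n)) (pair1_measurable a)).
rewrite (IH _ mfa (fun=> f0 _)).
apply: eq_integral => x _; apply: eq_integral => y _; congr f.
by rewrite row_mx_rV_cons.
Qed.

(** Tonelli applied to an indicator. Having the equality of measures, and not only of nonnegative
    integrals, moves signed integrands to the product space, where Fubini applies. *)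
Lemma lebesgue_rV_row_mx m n (A : set 'rV[R]_(m + n)) : measurable A ->
  lebesgue_rV (m + n) A = pushforward (lebesgue_rV m \x lebesgue_rV n)
    (fun p => row_mx p.1 p.2) A.
Proof.
move=> mA; have mrow := @measurable_row_mx_pair m n.
have mB : measurable ((fun p : 'rV[R]_m * 'rV[R]_n => row_mx p.1 p.2) @^-1` A).
  by rewrite -[X in measurable X]setTI; exact: mrow.
transitivity (\int[lebesgue_rV (m + n)]_z (\1_A z)%:E).
  by rewrite integral_indic// setIT.
have m1 : measurable_fun setT (fun z : 'rV[R]_(m + n) => (\1_A z : R)%:E).
  exact/measurable_EFinP/measurable_indic.
have p1 z : 0 <= (\1_A z : R)%:E by rewrite lee_fin.
rewrite (ge0_integral_row_mx m1 p1).
transitivity (\int[lebesgue_rV m \x lebesgue_rV n]_p (\1_A (row_mx p.1 p.2))%:E).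
  by rewrite fubini_tonelli1//; exact: (measurableT_comp m1 mrow).
rewrite /pushforward; set B := _ @^-1` A in mB *.
transitivity (\int[lebesgue_rV m \x lebesgue_rV n]_p (\1_B p)%:E) => //.
by rewrite integral_indic// setIT.
Qed.

Definition integrable_rV d (f : 'rV[R]_d -> R) :=
  (lebesgue_rV d).-integrable setT (EFin \o f).

Lemma integrable_row_mx_pair m n (f : 'rV[R]_(m + n) -> R) : integrable_rV f ->
  (lebesgue_rV m \x lebesgue_rV n).-integrable setT
    (fun p => (f (row_mx p.1 p.2))%:E).
Proof.
move=> intf; have mrow := @measurable_row_mx_pair m n.
have mf : measurable_fun setT (EFin \o f) by exact: measurable_int intf.
have mfp : measurable_fun setT (fun p : 'rV[R]_m * 'rV[R]_n => (f (row_mx p.1 p.2))%:E).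
  exact: (measurableT_comp mf mrow).
apply/integrableP; split=> //; rewrite fubini_tonelli1//; last first.
  exact: measurableT_comp.
have /integrableP[_] := intf.
by rewrite ge0_integral_row_mx//; exact: measurableT_comp.
Qed.

Lemma integral_row_mx_pair m n (f : 'rV[R]_(m + n) -> R) : integrable_rV f ->
  \int[lebesgue_rV (m + n)]_z (f z)%:E =
  \int[lebesgue_rV m \x lebesgue_rV n]_p (f (row_mx p.1 p.2))%:E.
Proof.
move=> intf; have mrow := @measurable_row_mx_pair m n.
have mf : measurable_fun setT (EFin \o f) by exact: measurable_int intf.
have intp := integrable_row_mx_pair intf.
transitivity (\int[pushforward (lebesgue_rV m \x lebesgue_rV n)
    (fun p => row_mx p.1 p.2)]_z (f z)%:E).
  by apply: eq_measure_integral => A mA _; exact: lebesgue_rV_row_mx.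
by rewrite (integral_pushforward mrow mf).
Qed.

(** Every slice, and not almost every one, is asked to be integrable: the inner [Rintegral] is a
    [fine], faithful only where the extended integral is finite. *)
Lemma Rintegral_row_mx m n (f : 'rV[R]_(m + n) -> R) :
  integrable_rV f ->
  (forall x, integrable_rV (fun y => f (row_mx x y))) ->
  (\int[lebesgue_rV (m + n)]_z f z =
   \int[lebesgue_rV m]_x \int[lebesgue_rV n]_y f (row_mx x y))%R.
Proof.
move=> intf intf1; congr fine; rewrite integral_row_mx_pair//.
rewrite -(integral12_prod_meas1 (integrable_row_mx_pair intf)).
apply: eq_integral => x _; rewrite /fubini_F fineK//.
by apply: integrable_fin_num => //; exact: intf1.
Qed.

Lemma Rintegral_row_mx_swap m n (f : 'rV[R]_(m + n) -> R) :
  integrable_rV f ->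
  (forall y, integrable_rV (fun x => f (row_mx x y))) ->
  (\int[lebesgue_rV (m + n)]_z f z =
   \int[lebesgue_rV n]_y \int[lebesgue_rV m]_x f (row_mx x y))%R.
Proof.
move=> intf intf1; congr fine; rewrite integral_row_mx_pair//.
rewrite -(integral21_prod_meas1 (integrable_row_mx_pair intf)).
apply: eq_integral => y _; rewrite /fubini_G fineK//.
by apply: integrable_fin_num => //; exact: intf1.
Qed.

Lemma Rintegral_rV_cons d (f : 'rV[R]_d.+1 -> R) :
  integrable_rV f ->
  (forall a, integrable_rV (fun x => f (rV_cons (a, x)))) ->
  (\int[lebesgue_rV d.+1]_x f x =
   \int[lebesgue_measure]_a \int[lebesgue_rV d]_x f (rV_cons (a, x)))%R.
Proof.
move=> intf intf1.
have mf : measurable_fun setT (EFin \o f) by exact: measurable_int intf.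
have intp : (lebesgue_measure \x lebesgue_rV d).-integrable setT
    (fun p => (f (rV_cons p))%:E).
  apply/integrableP; split; first exact: (measurableT_comp mf (@measurable_rV_cons R d)).
  rewrite fubini_tonelli1//; last first.
    by apply: measurableT_comp => //; exact: (measurableT_comp mf (@measurable_rV_cons R d)).
  have /integrableP[_] := intf.
  by rewrite ge0_integral_rV_cons//; exact: measurableT_comp.
congr fine.
transitivity (\int[lebesgue_measure \x lebesgue_rV d]_p (f (rV_cons p))%:E).
  exact: (@integral_pushforward _ _ _ _ R _ (@measurable_rV_cons R d)
    (lebesgue_measure \x lebesgue_rV d) setT _ mf).
rewrite -(integral12_prod_meas1 intp).
apply: eq_integral => x _; rewrite /fubini_F fineK//.
by apply: integrable_fin_num => //; exact: intf1.
Qed.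

End fubini_rV.

(** * Translation invariance of Lebesgue measure *)

Section translation.
Context {R : realType}.
Local Open Scope ereal_scope.

(** Uniqueness of the measure giving half-open intervals their length: a translation preserves these
    intervals and their lengths. *)
Lemma lebesgue_measureD (a : R) (A : set R) : measurable A ->
  pushforward lebesgue_measure (+%R a : _ -> measurableTypeR R) A =
  lebesgue_measure A.
Proof.
move=> mA; apply/esym.
have ma : measurable_fun setT (+%R a : measurableTypeR R -> measurableTypeR R).
  by apply: measurable_funD.
apply: (@lebesgue_measure_unique R
  (measure_function_pushforward__canonical__measure_function_Measure
    lebesgue_measure ma)) => //= _ [[x y]] _ <-.
rewrite /pushforward (_ : _ @^-1` _ = `](x - a)%R, (y - a)%R]%classic).
  rewrite !lebesgue_measure_itv/= !lte_fin ltrD2r.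
  by case: ifPn => // _; congr EFin; ring.
by apply/seteqP; split=> z; rewrite /= !in_itv/= ltrBlDl lerBrDl.
Qed.

Lemma ge0_integralD_shift (a : R) (f : R -> \bar R) :
  measurable_fun setT f -> (forall x, 0 <= f x) ->
  \int[lebesgue_measure]_x f (a + x)%R = \int[lebesgue_measure]_x f x.
Proof.
move=> mf f0.
have ma : measurable_fun setT (+%R a : measurableTypeR R -> measurableTypeR R).
  by apply: measurable_funD.
rewrite -[LHS](@ge0_integral_pushforward _ _ _ _ _ _ ma lebesgue_measure setT f)//.
by apply: eq_measure_integral => A mA _; exact: lebesgue_measureD.
Qed.

Lemma Rintegral_shift (a : R) (f : R -> R) : measurable_fun setT f ->
  (\int[lebesgue_measure]_x f (a + x) = \int[lebesgue_measure]_x f x)%R.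
Proof.
move=> mf; have mf' : measurable_fun setT (fun x : measurableTypeR R => (f x)%:E).
  exact/measurable_EFinP.
congr fine; rewrite [LHS]integralE [RHS]integralE; congr (_ - _).
  rewrite -(ge0_integralD_shift a (measurable_funepos mf') (funepos_ge0 _)).
  by apply: eq_integral => x _; rewrite !funeposE.
rewrite -(ge0_integralD_shift a (measurable_funeneg mf') (funeneg_ge0 _)).
by apply: eq_integral => x _; rewrite !funenegE.
Qed.

Lemma rV_consD d (a b : R) (x y : 'rV[R]_d) :
  (rV_cons (a, x) + rV_cons (b, y) = rV_cons ((a + b), (x + y)))%R.
Proof. by apply/rowP => i; rewrite !mxE; case: unlift => [j|//]; rewrite mxE. Qed.

Lemma ge0_integral_rV_shift d (v : 'rV[R]_d) (f : 'rV[R]_d -> \bar R) :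
  measurable_fun setT f -> (forall x, 0 <= f x) ->
  \int[lebesgue_rV d]_x f (v + x)%R = \int[lebesgue_rV d]_x f x.
Proof.
elim: d v f => [|d IH] v f mf f0.
  by apply: eq_integral => x _; congr f; apply/rowP => -[].
have mv : measurable_fun setT (fun x : 'rV[R]_d.+1 => v + x)%R.
  exact: measurable_vecD.
have mfc := measurableT_comp mf (@measurable_rV_cons R d).
rewrite [LHS](ge0_integral_rV_cons (measurableT_comp mf mv) (fun=> f0 _)) /=.
rewrite [RHS](ge0_integral_rV_cons mf f0).
rewrite -(rV_unconsK v); case: (rV_uncons v) => b w.
under eq_integral => a _.
  under eq_integral => x _ do rewrite rV_consD.
  rewrite (IH w (fun x => f (rV_cons (b + a, x))%R))//; last first.
    exact: (measurableT_comp mfc (pair1_measurable _)).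
  over.
rewrite (ge0_integralD_shift b (f := fun a => \int[lebesgue_rV d]_x f (rV_cons (a, x))))//.
  exact: (measurable_fun_fubini_tonelli_F (fun p => f (rV_cons p)) mfc).
by move=> x; exact: integral_ge0.
Qed.

Lemma integral_rV_shift d (v : 'rV[R]_d) (f : 'rV[R]_d -> \bar R) :
  measurable_fun setT f ->
  \int[lebesgue_rV d]_x f (v + x)%R = \int[lebesgue_rV d]_x f x.
Proof.
move=> mf; rewrite [LHS]integralE [RHS]integralE; congr (_ - _).
  rewrite -(ge0_integral_rV_shift v (measurable_funepos mf) (funepos_ge0 f)).
  by apply: eq_integral => x _; rewrite !funeposE.
rewrite -(ge0_integral_rV_shift v (measurable_funeneg mf) (funeneg_ge0 f)).
by apply: eq_integral => x _; rewrite !funenegE.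
Qed.

Lemma Rintegral_rV_shift d (v : 'rV[R]_d) (f : 'rV[R]_d -> R) :
  measurable_fun setT f ->
  (\int[lebesgue_rV d]_x f (v + x) = \int[lebesgue_rV d]_x f x)%R.
Proof.
move=> mf; congr fine.
rewrite -(integral_rV_shift v (f := fun x => (f x)%:E))//.
exact/measurable_EFinP.
Qed.

End translation.

(** * Gaussian integrals *)

Section derive1D.
Context {R : realType}.

Lemma is_derive_cos_comp (f : R -> R) (x df : R) :
  is_derive x 1 f df -> is_derive x 1 (fun y => cos (f y)) (- sin (f x) * df).
Proof. by move=> h; exact: (@is_derive1_comp R (@cos R) f x _ _ _ h). Qed.

Lemma is_derive_sin_comp (f : R -> R) (x df : R) :
  is_derive x 1 f df -> is_derive x 1 (fun y => sin (f y)) (cos (f x) * df).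
Proof. by move=> h; exact: (@is_derive1_comp R (@sin R) f x _ _ _ h). Qed.

Lemma is_derive_expR_comp (f : R -> R) (x df : R) :
  is_derive x 1 f df -> is_derive x 1 (fun y => expR (f y)) (expR (f x) * df).
Proof. by move=> h; exact: (@is_derive1_comp R (@expR R) f x _ _ _ h). Qed.

Lemma is_derive_mul (f g : R -> R) (x df dg : R) :
  is_derive x 1 f df -> is_derive x 1 g dg ->
  is_derive x 1 (fun y => f y * g y) (df * g x + f x * dg).
Proof.
by move=> hf hg; apply: is_derive_eq; rewrite /GRing.scale/= addrC (mulrC (g x)).
Qed.

Lemma is_derive_under_integral d (Y : measurableType d)
    (mu : {measure set Y -> \bar R}) (f df : R -> Y -> R) (G : Y -> R) (a e : R) :
  0 < e ->
  (forall s, `|s - a| < e -> mu.-integrable setT (EFin \o f s)) ->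
  (forall s y, `|s - a| < e -> is_derive s 1 (f ^~ y) (df s y)) ->
  (forall s y, `|s - a| < e -> `|df s y| <= G y) ->
  mu.-integrable setT (EFin \o G) ->
  is_derive a 1 (fun s => \int[mu]_y f s y) (\int[mu]_y df a y).
Proof.
move=> e0 intf fdf dfG intG.
have Ie s : `](a - e), (a + e)[%classic s -> `|s - a| < e.
  by rewrite /= in_itv/= ltr_distl.
have Ia : `](a - e), (a + e)[%classic a by rewrite /= in_itv/=; lra.
have G0 y : 0 <= G y by rewrite (le_trans _ (dfG a y _))// subrr normr0.
have intf' s : `](a - e), (a + e)[%classic s -> mu.-integrable setT (EFin \o f s).
  by move=> /Ie; exact: intf.
have der s y : `](a - e), (a + e)[%classic s -> setT y -> derivable (f ^~ y) s 1.
  by move=> /Ie /(fdf _ y) h _; exact: ex_derive.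
have dE s y : `|s - a| < e -> partial1of2 f s y = df s y.
  by move=> /(fdf _ y) h; rewrite partial1of2E derive_val.
have Gub s y : `](a - e), (a + e)[%classic s -> setT y -> `|partial1of2 f s y| <= G y.
  by move=> /Ie h _; rewrite dE//; exact: dfG.
apply: DeriveDef.
  exact: (derivable_under_integral measurableT Ia intf' der G0 intG Gub).
rewrite -derive1E.
rewrite (differentiation_under_integral measurableT Ia intf' der G0 intG Gub).
by apply: eq_Rintegral => y _; rewrite dE// subrr normr0.
Qed.

Lemma is_derive_under_integralR (f df : R -> R -> R) (G : R -> R) (a e : R) :
  0 < e ->
  (forall s, `|s - a| < e -> lebesgue_measure.-integrable setT (EFin \o f s)) ->
  (forall s y, `|s - a| < e -> is_derive s 1 (f ^~ y) (df s y)) ->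
  (forall s y, `|s - a| < e -> `|df s y| <= G y) ->
  lebesgue_measure.-integrable setT (EFin \o G) ->
  is_derive a 1 (fun s => \int[lebesgue_measure]_y f s y)
    (\int[lebesgue_measure]_y df a y).
Proof. exact: (@is_derive_under_integral _ (measurableTypeR R) lebesgue_measure). Qed.

End derive1D.

Section integrable_lemmas.
Context {R : realType} d (T : measurableType d) (mu : {measure set T -> \bar R}).

Lemma ge0_integrable (f : T -> R) : measurable_fun setT f -> (forall x, 0 <= f x) ->
  (\int[mu]_x (f x)%:E < +oo)%E -> mu.-integrable setT (EFin \o f).
Proof.
move=> mf f0 foo; apply/integrableP; split; first exact/measurable_EFinP.
by under eq_integral do rewrite /= ger0_norm//.
Qed.

Lemma integrable_le (f g : T -> R) : measurable_fun setT f ->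
  mu.-integrable setT (EFin \o g) -> (forall x, `|f x| <= g x) ->
  mu.-integrable setT (EFin \o f).
Proof.
move=> mf intg fg; apply: le_integrable intg => //; first exact/measurable_EFinP.
by move=> x _ /=; rewrite lee_fin (le_trans (fg x))// ler_norm.
Qed.

End integrable_lemmas.

Lemma integrable_leR {R : realType} (f g : R -> R) : measurable_fun setT f ->
  lebesgue_measure.-integrable setT (EFin \o g) -> (forall x, `|f x| <= g x) ->
  lebesgue_measure.-integrable setT (EFin \o f).
Proof. exact: (@integrable_le R _ (measurableTypeR R) lebesgue_measure). Qed.

Section gauss1D.
Context {R : realType}.
Implicit Types (a c s x theta : R).

Lemma integral_gauss c : 0 < c ->
  (\int[lebesgue_measure]_x (expR (- c * x ^+ 2))%:E = (Num.sqrt (pi / c))%:E)%E.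
Proof.
(* The normal density of variance 1/(2c) is a multiple of exp (- c x^2). *)
move=> c0; pose s := (Num.sqrt (2 * c))^-1.
have s2 : s ^+ 2 = (2 * c)^-1 by rewrite exprVn sqr_sqrtr// mulr_ge0// ltW.
have s0 : s != 0 by rewrite invr_neq0// sqrtr_eq0 -ltNge mulr_gt0.
have E : pi / c = s ^+ 2 * pi *+ 2.
  by rewrite s2 -mulr_natr; field; rewrite gt_eqF.
have p0 : 0 < Num.sqrt (pi / c) by rewrite sqrtr_gt0 divr_gt0// pi_gt0.
transitivity (\int[lebesgue_measure]_x
  ((Num.sqrt (pi / c))%:E * (normal_pdf 0 s x)%:E))%E.
  apply: eq_integral => x _; rewrite (normal_pdfE _ s0) -EFinM /normal_peak -E.
  rewrite mulVKf ?gt_eqF//.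
  congr (expR _)%:E; rewrite subr0 s2 -mulr_natr; field; rewrite gt_eqF//.
rewrite ge0_integralZl_EFin ?sqrtr_ge0//.
- by rewrite integral_normal_pdf mule1.
- by move=> x _; rewrite lee_fin normal_pdf_ge0.
- by apply/measurable_EFinP; exact: measurable_normal_pdf.
Qed.

Lemma measurable_gauss c : measurable_fun [set: R] (fun x : R => expR (- c * x ^+ 2)).
Proof. by apply: measurable_expR_comp; apply: measurable_funM => //; apply: measurable_funX. Qed.

Lemma integrable_gauss c : 0 < c ->
  lebesgue_measure.-integrable setT (EFin \o (fun x => expR (- c * x ^+ 2))).
Proof.
move=> c0; apply: ge0_integrable => [|x|]; first exact: measurable_gauss.
  exact: expR_ge0.
by rewrite integral_gauss// ltry.
Qed.

(** Half of the decay rate pays for the factor |x|, since |x| <= (1 + 1/c) (1 + c x^2 / 2) and 1 + y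
    <= exp y. *)
Lemma abs_gauss_le c x : 0 < c ->
  `|x| * expR (- c * x ^+ 2) <= (1 + c^-1) * expR (- (c / 2) * x ^+ 2).
Proof.
move=> c0.
have -> : - (c / 2) * x ^+ 2 = - c * x ^+ 2 + c / 2 * x ^+ 2 by field.
rewrite expRD [leRHS]mulrA [leRHS]mulrAC ler_pM2r ?expR_gt0//.
have h1 := expR_ge1Dx (c / 2 * x ^+ 2).
have : `|x| <= (1 + c^-1) * (1 + c / 2 * x ^+ 2).
  have -> : (1 + c^-1) * (1 + c / 2 * x ^+ 2) =
    1 + c / 2 * x ^+ 2 + c^-1 + x ^+ 2 / 2 by field; rewrite gt_eqF.
  have h2 : 0 <= c / 2 * x ^+ 2 by rewrite mulr_ge0 ?sqr_ge0// divr_ge0// ltW.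
  have h3 : 0 < c^-1 by rewrite invr_gt0.
  have h4 : x ^+ 2 = `|x| ^+ 2 by rewrite real_normK ?num_real.
  have := sqr_ge0 (`|x| - 1); rewrite h4; nra.
move=> /le_trans; apply; rewrite ler_wpM2l// addr_ge0// ?invr_ge0 ltW//.
Qed.

(* Translation invariance makes the integral of the derivative of
   [sin (theta + a x) exp (- c x^2)] vanish, which is the integration by parts
   behind the differential equation for the Fourier transform. *)
Lemma gauss_by_parts c a theta : 0 < c ->
  \int[lebesgue_measure]_x ((a * cos (theta + a * x) -
     2 * c * x * sin (theta + a * x)) * expR (- c * x ^+ 2)) = 0.
Proof.
move=> c0; pose h x := sin (theta + a * x) * expR (- c * x ^+ 2).
pose dh x := (a * cos (theta + a * x) - 2 * c * x * sin (theta + a * x)) *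
  expR (- c * x ^+ 2).
have mh : measurable_fun setT h.
  apply: measurable_funM; last exact: measurable_gauss.
  by apply: measurable_sin_comp; apply: measurable_funD => //; apply: measurable_funM.
have h_le x : `|h x| <= expR (- c * x ^+ 2).
  by rewrite normrM (ger0_norm (expR_ge0 _)) ler_piMl ?expR_ge0// ler_norml sin_geN1 sin_le1.
have hs s x : is_derive s 1 (fun s => h (s + x)) (dh (s + x)).
  have d1 : is_derive s 1 (fun s => theta + a * (s + x)) a.
    by apply: is_derive_eq; rewrite /GRing.scale/=; ring.
  have d2 : is_derive s 1 (fun s => - c * (s + x) ^+ 2) (- (2 * c * (s + x))).
    by apply: is_derive_eq; rewrite /GRing.scale/=; ring.
  apply: (is_derive_eq (is_derive_mul (is_derive_sin_comp d1) (is_derive_expR_comp d2))).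
  by rewrite /dh; ring.
pose C : R := `|a| + 2 * c * (1 + c^-1).
have dh_le y : `|dh y| <= C * expR (- (c / 2) * y ^+ 2).
  rewrite normrM (ger0_norm (expR_ge0 _)).
  apply: (@le_trans _ _ ((`|a| + 2 * c * `|y|) * expR (- c * y ^+ 2))).
    rewrite ler_wpM2r ?expR_ge0// (le_trans (ler_normB _ _))// !normrM lerD//.
      by rewrite ler_piMr// ler_norml cos_geN1 cos_le1.
    rewrite (ger0_norm (ltW c0)) (@ger0_norm _ 2)// ler_piMr//.
      by rewrite !mulr_ge0// ltW.
    by rewrite ler_norml sin_geN1 sin_le1.
  rewrite /C [leLHS]mulrDl [leRHS]mulrDl lerD//.
    rewrite ler_wpM2l// ler_expR; have := sqr_ge0 y; nra.
  by rewrite -!mulrA ler_pM2l// ler_pM2l// abs_gauss_le.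
(* Domination uniform in the shift, from (s + x)^2 >= x^2 / 2 - s^2. *)
have shift_le s x : `|s - 0| < 1 ->
    expR (- (c / 2) * (s + x) ^+ 2) <= expR (c / 2) * expR (- (c / 4) * x ^+ 2).
  rewrite subr0 ltr_norml => /andP[s1 s2]; rewrite -expRD ler_expR.
  have : s ^+ 2 <= 1 by nra.
  have := sqr_ge0 (s + x / 2); nra.
have mhs s : measurable_fun setT (fun x => h (s + x)).
  by apply: (measurableT_comp mh); apply: measurable_funD.
have c4 : 0 < c / 4 by rewrite divr_gt0.
have intG : lebesgue_measure.-integrable setT
    (EFin \o (fun x : measurableTypeR R => C * (expR (c / 2) * expR (- (c / 4) * x ^+ 2)))).
  have := integrableZl measurableT (C * expR (c / 2)) (integrable_gauss c4).
  by apply: eq_integrable => // x _ /=; rewrite -EFinM mulrA.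
have inth s : `|s - 0| < 1 -> lebesgue_measure.-integrable setT
    (EFin \o (fun x : measurableTypeR R => h (s + x))).
  move=> s1; have I := integrableZl measurableT (expR (c / 2)) (integrable_gauss c4).
  apply: (integrable_leR (g := fun x => expR (c / 2) * expR (- (c / 4) * x ^+ 2))
    (mhs s) I).
  move=> x; rewrite (le_trans (h_le _))// (le_trans _ (shift_le s x s1))// ler_expR.
  by have := sqr_ge0 (s + x); nra.
have der := is_derive_under_integralR ltr01 inth (fun s x _ => hs s x) _ intG.
have {}der : is_derive (0 : R) 1 (fun s => \int[lebesgue_measure]_x h (s + x))
   (\int[lebesgue_measure]_x dh (0 + x)).
  apply: der => s x s1; rewrite (le_trans (dh_le _))// ler_wpM2l ?shift_le//.
  by rewrite addr_ge0// !mulr_ge0// ?addr_ge0// ?invr_ge0 ltW.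
have cstE s : \int[lebesgue_measure]_x h (s + x) = \int[lebesgue_measure]_x h x.
  exact: (@Rintegral_shift _ s h).
rewrite -[LHS]/(\int[lebesgue_measure]_x dh x).
have -> : \int[lebesgue_measure]_x dh x = \int[lebesgue_measure]_x dh (0 + x).
  by apply: eq_Rintegral => x _; rewrite add0r.
have <- := @derive_val _ _ _ _ _ _ _ der.
by under eq_fun do rewrite cstE; rewrite derive_cst.
Qed.

(** As a function of [a] the integral solves F' = - a F / (2 c), so F exp (a^2 / (4 c)) is constant.
    The phase [theta] serves twice: in R^d it collects the contribution of the other coordinates,
    and theta = - pi / 2 turns the cosine into a sine. *)
Lemma Rintegral_cos_gauss c a theta : 0 < c ->
  \int[lebesgue_measure]_x (cos (theta + a * x) * expR (- c * x ^+ 2)) =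
  cos theta * Num.sqrt (pi / c) * expR (- a ^+ 2 / (4 * c)).
Proof.
move=> c0.
pose F a := \int[lebesgue_measure]_x (cos (theta + a * x) * expR (- c * x ^+ 2)).
have mcos b : measurable_fun setT (fun x => cos (theta + b * x)).
  by apply: measurable_cos_comp; apply: measurable_funD => //; apply: measurable_funM.
have msin b : measurable_fun setT (fun x => sin (theta + b * x)).
  by apply: measurable_sin_comp; apply: measurable_funD => //; apply: measurable_funM.
have mg := measurable_gauss c.
have intcos b : lebesgue_measure.-integrable setT
    (EFin \o (fun x : measurableTypeR R => cos (theta + b * x) * expR (- c * x ^+ 2))).
  apply: (integrable_leR (g := fun x => expR (- c * x ^+ 2)) _ (integrable_gauss c0)).
    exact: measurable_funM.
  move=> x; rewrite normrM (ger0_norm (expR_ge0 _)) ler_piMl ?expR_ge0//.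
  by rewrite ler_norml cos_geN1 cos_le1.
have c2 : 0 < c / 2 by rewrite divr_gt0.
have c2' : 0 < 2 * c by rewrite mulr_gt0.
have intabs : lebesgue_measure.-integrable setT
    (EFin \o (fun x : measurableTypeR R => (1 + c^-1) * expR (- (c / 2) * x ^+ 2))).
  exact: (integrableZl measurableT (1 + c^-1) (integrable_gauss c2)).
have sin_le b x : `|x * sin (theta + b * x) * expR (- c * x ^+ 2)| <=
    (1 + c^-1) * expR (- (c / 2) * x ^+ 2).
  rewrite (le_trans _ (abs_gauss_le _ c0))// !normrM (ger0_norm (expR_ge0 _)).
  by rewrite ler_wpM2r ?expR_ge0// ler_piMr// ler_norml sin_geN1 sin_le1.
have intsin b : lebesgue_measure.-integrable setT
    (EFin \o (fun x : measurableTypeR R => x * sin (theta + b * x) * expR (- c * x ^+ 2))).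
  apply: (integrable_leR _ intabs (sin_le b)).
  by apply: measurable_funM => //; apply: measurable_funM.
have dF (b : R) : is_derive b 1 F (- (b / (2 * c)) * F b).
  have der : is_derive b 1 F
      (\int[lebesgue_measure]_x - (x * sin (theta + b * x) * expR (- c * x ^+ 2))).
    apply: (is_derive_under_integralR
      (df := fun s x => - (x * sin (theta + s * x) * expR (- c * x ^+ 2)))
      ltr01 (fun s _ => intcos s) _ _ intabs) => s x _.
      have d1 : is_derive s 1 (fun s => theta + s * x) x.
        by apply: is_derive_eq; rewrite /GRing.scale/=; ring.
      have := is_derive_mul (is_derive_cos_comp d1)
        (is_derive_cst (expR (- c * x ^+ 2)) s 1).
      by move/is_derive_eq; apply; rewrite /cst; ring.
    by rewrite normrN; exact: sin_le.
  apply: (is_derive_eq der).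
  have := gauss_by_parts b theta c0.
  have -> : \int[lebesgue_measure]_x ((b * cos (theta + b * x) -
      2 * c * x * sin (theta + b * x)) * expR (- c * x ^+ 2)) =
    b * F b - 2 * c * \int[lebesgue_measure]_x
      (x * sin (theta + b * x) * expR (- c * x ^+ 2)).
    rewrite -!RintegralZl// -RintegralB//.
    - by apply: eq_Rintegral => x _; ring.
    - exact: (integrableZl measurableT b (intcos b)).
    - exact: (integrableZl measurableT (2 * c) (intsin b)).
  have -> : \int[lebesgue_measure]_x (- (x * sin (theta + b * x) * expR (- c * x ^+ 2)))
     = - \int[lebesgue_measure]_x (x * sin (theta + b * x) * expR (- c * x ^+ 2)).
    transitivity (\int[lebesgue_measure]_x (-1 *
      (x * sin (theta + b * x) * expR (- c * x ^+ 2)))).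
      by apply: eq_Rintegral => x _; ring.
    by rewrite RintegralZl// mulN1r.
  move=> H; apply: (mulfI (lt0r_neq0 c2')).
  rewrite mulrN -(subr0_eq H); field; exact: lt0r_neq0.
have F0 : F 0 = cos theta * Num.sqrt (pi / c).
  rewrite /F; under eq_Rintegral do rewrite mul0r addr0.
  rewrite RintegralZl//; last exact: integrable_gauss.
  by rewrite /Rintegral integral_gauss.
have dG (b : R) : is_derive b 1 (fun b => F b * expR (b ^+ 2 / (4 * c))) 0.
  have d1 : is_derive b 1 (fun b => b ^+ 2 / (4 * c)) (b / (2 * c)).
    apply: is_derive_eq; rewrite /GRing.scale/=; field; rewrite gt_eqF//.
  apply: (is_derive_eq (is_derive_mul (dF b) (is_derive_expR_comp d1))).
  by ring.
have := @is_derive_0_is_cst R _ a 0 dG.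
rewrite expr0n/= mul0r expR0 mulr1 F0 => <-.
by rewrite -mulrA -expRD mulNr subrr expR0 mulr1.
Qed.

End gauss1D.

(** * Functions with Gaussian decay on R^d *)

Section gauss_bounded.
Context {R : realType}.
Implicit Types (d m n : nat).

Lemma integral_gauss_rV d (c : R) : 0 < c ->
  (\int[lebesgue_rV d]_x (expR (- c * dot x x))%:E =
   (Num.sqrt (pi / c) ^+ d)%:E)%E.
Proof.
move=> c0; elim: d => [|d IH].
  rewrite integral_dirac// ?diracT ?mul1e ?dot0l ?mulr0 ?expR0//.
  by apply/measurable_EFinP/measurable_expR_comp/measurable_funM => //; exact: measurable_dot.
have mg m : measurable_fun setT (fun x : 'rV[R]_m => expR (- c * dot x x)).
  by apply/measurable_expR_comp/measurable_funM => //; exact: measurable_dot.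
rewrite ge0_integral_rV_cons//; last by apply/measurable_EFinP; exact: mg.
transitivity (\int[lebesgue_measure]_a
  ((Num.sqrt (pi / c) ^+ d)%:E * (expR (- c * a ^+ 2))%:E))%E.
  apply: eq_integral => a _.
  under eq_integral do rewrite dot_rV_cons mulrDr expRD EFinM.
  rewrite ge0_integralZl_EFin.
  - by rewrite IH muleC expr2.
  - exact: measurableT.
  - by move=> x _; rewrite lee_fin expR_ge0.
  - by apply/measurable_EFinP; exact: mg.
  - exact: expR_ge0.
rewrite ge0_integralZl_EFin ?exprn_ge0 ?sqrtr_ge0//.
- by rewrite integral_gauss// -EFinM exprSr.
- by apply/measurable_EFinP; exact: measurable_gauss.
Qed.

Lemma measurable_gauss_rV d (c : R) :
  measurable_fun setT (fun x : 'rV[R]_d => expR (- c * dot x x)).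
Proof. by apply/measurable_expR_comp/measurable_funM => //; exact: measurable_dot. Qed.

Lemma integrable_gauss_rV d (c : R) : 0 < c ->
  integrable_rV (fun x : 'rV[R]_d => expR (- c * dot x x)).
Proof.
move=> c0; apply: ge0_integrable => [|x|]; first exact: measurable_gauss_rV.
  exact: expR_ge0.
by rewrite integral_gauss_rV// ltry.
Qed.

(** A class that carries all integrability checks: it is stable under sums, bounded measurable
    factors and translations, and every slice of a member is again a member, which is what the
    Fubini lemmas ask for. *)
Definition gauss_bounded d (f : 'rV[R]_d -> R) : Prop :=
  measurable_fun setT f /\
  exists C c, 0 < c /\ forall x, `|f x| <= C * expR (- c * dot x x).

Lemma gauss_bounded_integrable d (f : 'rV[R]_d -> R) :
  gauss_bounded f -> integrable_rV f.
Proof.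
move=> [mf [C [c [c0 fC]]]]; apply: (integrable_le mf _ fC).
exact: (integrableZl measurableT C (integrable_gauss_rV d c0)).
Qed.

Lemma gauss_bounded_gauss d (c : R) : 0 < c ->
  gauss_bounded (fun x : 'rV[R]_d => expR (- c * dot x x)).
Proof.
move=> c0; split; first exact: measurable_gauss_rV.
by exists 1, c; split=> // x; rewrite mul1r ger0_norm ?expR_ge0.
Qed.

Lemma gauss_bounded_le d (f g : 'rV[R]_d -> R) (M : R) : measurable_fun setT f ->
  gauss_bounded g -> (forall x, `|f x| <= M * `|g x|) -> gauss_bounded f.
Proof.
move=> mf [mg [C [c [c0 gC]]]] fg; split=> //; exists (`|M| * C), c; split=> // x.
rewrite (le_trans (fg x))// -mulrA (le_trans (ler_wpM2r _ (ler_norm M)))//.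
by rewrite ler_wpM2l.
Qed.

Lemma gauss_boundedM d (b f : 'rV[R]_d -> R) (M : R) : measurable_fun setT b ->
  (forall x, `|b x| <= M) -> gauss_bounded f -> gauss_bounded (fun x => b x * f x).
Proof.
move=> mb bM gf; apply: (gauss_bounded_le (M := M) _ gf) => [|x].
  by apply: measurable_funM => //; case: gf.
by rewrite normrM ler_wpM2r.
Qed.

Lemma gauss_boundedZ d (a : R) (f : 'rV[R]_d -> R) : gauss_bounded f ->
  gauss_bounded (fun x => a * f x).
Proof. by move=> gf; apply: (gauss_boundedM (M := `|a|)) gf => // x. Qed.

Lemma gauss_bounded0 d : gauss_bounded (fun _ : 'rV[R]_d => 0).
Proof.
split=> //; exists 0, 1; split=> // x; by rewrite normr0 mul0r.
Qed.

Lemma gauss_boundedD d (f g : 'rV[R]_d -> R) : gauss_bounded f -> gauss_bounded g ->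
  gauss_bounded (fun x => f x + g x).
Proof.
move=> [mf [C1 [c1 [c10 fC]]]] [mg [C2 [c2 [c20 gC]]]].
split; first exact: measurable_funD.
exists (`|C1| + `|C2|), (Num.min c1 c2); split=> [|x]; first by rewrite lt_min c10.
rewrite (le_trans (ler_normD _ _))// mulrDl lerD//.
  rewrite (le_trans (fC x))// (le_trans (ler_wpM2r (expR_ge0 _) (ler_norm C1)))//.
  by rewrite ler_wpM2l// ler_expR ler_wpM2r ?dot_ge0// lerN2 ge_min lexx.
rewrite (le_trans (gC x))// (le_trans (ler_wpM2r (expR_ge0 _) (ler_norm C2)))//.
by rewrite ler_wpM2l// ler_expR ler_wpM2r ?dot_ge0// lerN2 ge_min lexx orbT.
Qed.

Lemma gauss_boundedN d (f : 'rV[R]_d -> R) : gauss_bounded f ->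
  gauss_bounded (fun x => - f x).
Proof.
by move=> /(gauss_boundedZ (-1)); under eq_fun do rewrite mulN1r.
Qed.

Lemma gauss_bounded_sum d I (r : seq I) (f : I -> 'rV[R]_d -> R) :
  (forall i, gauss_bounded (f i)) -> gauss_bounded (fun x => \sum_(i <- r) f i x).
Proof.
move=> gf; elim: r => [|i r IH].
  by under eq_fun do rewrite big_nil; exact: gauss_bounded0.
by under eq_fun do rewrite big_cons; exact: gauss_boundedD.
Qed.

Lemma Rintegral_rV_sum d I (r : seq I) (f : I -> 'rV[R]_d -> R) :
  (forall i, gauss_bounded (f i)) ->
  \int[lebesgue_rV d]_x (\sum_(i <- r) f i x) =
  \sum_(i <- r) \int[lebesgue_rV d]_x f i x.
Proof.
move=> gf; elim: r => [|i r IH].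
  rewrite big_nil; under eq_Rintegral do rewrite big_nil.
  by rewrite Rintegral_cst// mul0r.
rewrite big_cons -IH -RintegralD//.
- by apply: eq_Rintegral => x _; rewrite big_cons.
- exact: gauss_bounded_integrable.
- exact/gauss_bounded_integrable/gauss_bounded_sum.
Qed.

(* The decay of [f \o phi] only needs [phi] to expand distances up to constants. *)
Lemma gauss_bounded_comp m n (phi : 'rV[R]_m -> 'rV[R]_n) (f : 'rV[R]_n -> R) (k b : R) :
  measurable_fun setT phi -> 0 < k ->
  (forall x, k * dot x x <= dot (phi x) (phi x) + b) ->
  gauss_bounded f -> gauss_bounded (f \o phi).
Proof.
move=> mphi k0 phik [mf [C [c [c0 fC]]]]; split; first exact: measurableT_comp.
exists (`|C| * expR (c * b)), (c * k); split=> [|x]; first exact: mulr_gt0.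
rewrite (le_trans (fC _))// (le_trans (ler_wpM2r (expR_ge0 _) (ler_norm C)))//.
rewrite -mulrA -expRD ler_wpM2l// ler_expR.
by have := ler_wpM2l (ltW c0) (phik x); lra.
Qed.

Lemma gauss_bounded_shift d (v : 'rV[R]_d) (f : 'rV[R]_d -> R) :
  gauss_bounded f -> gauss_bounded (fun x => f (v + x)).
Proof.
apply: (@gauss_bounded_comp _ _ (fun x => v + x) f 2^-1 (dot v v)) => // [|x].
  exact: measurable_vecD.
by have := dot_sub_le (v + x) v; rewrite addrC addKr; lra.
Qed.

Lemma gauss_bounded_row_mxr m n (x : 'rV[R]_m) (f : 'rV[R]_(m + n) -> R) :
  gauss_bounded f -> gauss_bounded (fun y => f (row_mx x y)).
Proof.
apply: (@gauss_bounded_comp _ _ (fun y => row_mx x y) f 1 0) => // [|y].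
  exact: measurable_row_mx.
by rewrite dot_row_mx; have := dot_ge0 x; lra.
Qed.

Lemma gauss_bounded_row_mxl m n (y : 'rV[R]_n) (f : 'rV[R]_(m + n) -> R) :
  gauss_bounded f -> gauss_bounded (fun x => f (row_mx x y)).
Proof.
apply: (@gauss_bounded_comp _ _ (fun x => row_mx x y) f 1 0) => // [|x].
  exact: measurable_row_mx.
by rewrite dot_row_mx; have := dot_ge0 y; lra.
Qed.

(** The map (u, w) to (u/2 + w, u/2 - w) has Jacobian of modulus 1. It is a composition of two
    shears, so Fubini and translations replace a determinant: for fixed x put y = u - x, exchange
    the integrals, then for fixed u put x = u/2 + w. *)
Lemma Rintegral_rotate n (f : 'rV[R]_(n + n) -> R) : gauss_bounded f ->
  \int[lebesgue_rV (n + n)]_z f z =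
  \int[lebesgue_rV n]_u \int[lebesgue_rV n]_w
    f (row_mx (2^-1 *: u + w) (2^-1 *: u - w)).
Proof.
move=> gf; rewrite Rintegral_row_mx; last 2 first.
- exact: gauss_bounded_integrable.
- by move=> x; exact/gauss_bounded_integrable/gauss_bounded_row_mxr.
pose g (z : 'rV[R]_(n + n)) := f (row_mx (lsubmx z) (rsubmx z - lsubmx z)).
have gg : gauss_bounded g.
  (* With z = (x, u): |u|^2 <= 2 |u - x|^2 + 2 |x|^2, hence |x|^2 + |u|^2 <= 3 (|x|^2 + |u -
     x|^2). *)
  apply: (gauss_bounded_comp (k := 3^-1) (b := 0)) gf => // [|z].
    apply: measurable_row_mx; first exact: measurable_lsubmx.
    apply: measurable_vecD; first exact: measurable_rsubmx.
    by apply: measurable_vecN; exact: measurable_lsubmx.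
  rewrite -{1 2}(hsubmxK z) !dot_row_mx.
  have := dot_sub_le (rsubmx z - lsubmx z) (- lsubmx z).
  rewrite opprK subrK (dotNl (lsubmx z)) dotNr opprK.
  have := dot_ge0 (rsubmx z - lsubmx z); lra.
transitivity (\int[lebesgue_rV n]_x \int[lebesgue_rV n]_u g (row_mx x u)).
  apply: eq_Rintegral => x _.
  rewrite -(Rintegral_rV_shift (- x)); last first.
    by have [] := gauss_bounded_row_mxr x gf.
  by apply: eq_Rintegral => u _; rewrite /g row_mxKl row_mxKr addrC.
rewrite -Rintegral_row_mx ?Rintegral_row_mx_swap; last 4 first.
- exact: gauss_bounded_integrable.
- by move=> x; exact/gauss_bounded_integrable/gauss_bounded_row_mxl.
- exact: gauss_bounded_integrable.
- by move=> x; exact/gauss_bounded_integrable/gauss_bounded_row_mxr.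
apply: eq_Rintegral => u _.
rewrite -(Rintegral_rV_shift (2^-1 *: u)); last first.
  by have [] := gauss_bounded_row_mxl u gg.
apply: eq_Rintegral => w _; rewrite /g row_mxKl row_mxKr; congr (f (row_mx _ _)).
by rewrite opprD addrA; congr (_ - _); rewrite -{1}(scale1r u) -scalerBl; congr (_ *: _); field.
Qed.

Lemma Rintegral_cos_gauss_rV d (a : 'rV[R]_d) (c theta : R) : 0 < c ->
  \int[lebesgue_rV d]_x (cos (theta + dot a x) * expR (- c * dot x x)) =
  cos theta * Num.sqrt (pi / c) ^+ d * expR (- dot a a / (4 * c)).
Proof.
move=> c0.
have mc m t (b : 'rV[R]_m) : measurable_fun setT (fun x => cos (t + dot b x)).
  by apply/measurable_cos_comp/measurable_funD => //; exact: measurable_dot.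
have cos_bound (y : R) : `|cos y| <= 1 by rewrite ler_norml cos_geN1 cos_le1.
have gcos m t (b : 'rV[R]_m) :
    gauss_bounded (fun x => cos (t + dot b x) * expR (- c * dot x x)).
  apply: (gauss_boundedM (M := 1)) => //; exact: gauss_bounded_gauss.
elim: d a theta => [|d IH] a theta.
  rewrite /Rintegral integral_dirac//; last first.
    by apply/measurable_EFinP; case: (gcos 0%N theta a).
  rewrite diracT mul1e /= !dot0r addr0 mulr0 expR0 expr0.
  have -> : dot a a = 0 by rewrite /dot big_ord0.
  by rewrite oppr0 mul0r expR0 !mulr1.
rewrite -(rV_unconsK a); case: (rV_uncons a) => b v.
rewrite Rintegral_rV_cons; last 2 first.
- exact/gauss_bounded_integrable/gcos.
- move=> x; apply/gauss_bounded_integrable.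
  have := gauss_boundedZ (expR (- c * x ^+ 2)) (gcos d (theta + b * x) v).
  congr gauss_bounded; apply/funext => y; rewrite !dot_rV_cons addrA mulrCA -expRD.
  by congr (_ * expR _); ring.
transitivity (\int[lebesgue_measure]_x (Num.sqrt (pi / c) ^+ d *
    expR (- dot v v / (4 * c)) * (cos (theta + b * x) * expR (- c * x ^+ 2)))).
  apply: eq_Rintegral => x _.
  transitivity (\int[lebesgue_rV d]_y (expR (- c * x ^+ 2) *
     (cos (theta + b * x + dot v y) * expR (- c * dot y y)))).
    apply: eq_Rintegral => y _; rewrite !dot_rV_cons addrA mulrCA -expRD.
    by congr (_ * expR _); ring.
  rewrite RintegralZl//; last exact/gauss_bounded_integrable/gcos.
  by rewrite IH; ring.
rewrite RintegralZl//; last first.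
  apply: (integrable_leR (g := fun x => expR (- c * x ^+ 2)) _ (integrable_gauss c0)).
    apply: measurable_funM; last exact: measurable_gauss.
    by apply: measurable_cos_comp; apply: measurable_funD => //; apply: measurable_funM.
  by move=> x; rewrite normrM (ger0_norm (expR_ge0 _)) ler_piMl ?expR_ge0.
rewrite Rintegral_cos_gauss// dot_rV_cons.
have -> : - (b * b + dot v v) / (4 * c) = - dot v v / (4 * c) + - b ^+ 2 / (4 * c).
  by field; rewrite gt_eqF.
by rewrite expRD (exprS _ d); ring.
Qed.

End gauss_bounded.

(** * Complex integrals and the Fourier transform *)

Section complex_integral.
Context {R : realType}.
Implicit Types (d m n : nat).

Lemma cexpiD (a b : R) : cexpi (a + b) = cexpi a * cexpi b.
Proof. by rewrite /cexpi cosD sinD; simpc; congr Complex; ring. Qed.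

Lemma cexpi0 : cexpi 0 = 1 :> R[i].
Proof. by rewrite /cexpi cos0 sin0. Qed.

Lemma cexpiNK (a : R) : cexpi (- a) * cexpi a = 1.
Proof. by rewrite -cexpiD addNr cexpi0. Qed.

Lemma cmodM (x y : R[i]) : cmod (x * y) = cmod x * cmod y.
Proof. exact: Normc.normcM. Qed.

Lemma cmod_cexpi (a : R) : cmod (cexpi a) = 1.
Proof. by rewrite /cmod /= cos2Dsin2 sqrtr1. Qed.

Lemma cmod_real (a : R) : cmod a%:C%C = `|a|.
Proof. by rewrite /cmod /= expr0n/= addr0 sqrtr_sqr. Qed.

Lemma Re_le_cmod (z : R[i]) : complex.Re z <= cmod z.
Proof.
case: z => a b; rewrite /cmod /= (le_trans (ler_norm a))//.
by rewrite -sqrtr_sqr ler_wsqrtr// lerDl sqr_ge0.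
Qed.

Lemma eq_cintegral d (f g : 'rV[R]_d -> R[i]) : f =1 g -> cintegral f = cintegral g.
Proof. by move=> /funext ->. Qed.

Definition cgauss_bounded d (f : 'rV[R]_d -> R[i]) : Prop :=
  gauss_bounded (fun x => complex.Re (f x)) /\ gauss_bounded (fun x => complex.Im (f x)).

Lemma cgauss_bounded_real d (f : 'rV[R]_d -> R) : gauss_bounded f ->
  cgauss_bounded (fun x => (f x)%:C%C).
Proof. by move=> gf; split=> //=; exact: gauss_bounded0. Qed.

Lemma cgauss_boundedZ d (c : R[i]) (f : 'rV[R]_d -> R[i]) : cgauss_bounded f ->
  cgauss_bounded (fun x => c * f x).
Proof.
case: c => a b [g1 g2]; split.
  apply: (eq_ind _ (@gauss_bounded R d) (gauss_boundedD (gauss_boundedZ a g1)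
    (gauss_boundedZ (- b) g2))).
  by apply/funext => x; case: (f x) => u v /=; ring.
apply: (eq_ind _ (@gauss_bounded R d) (gauss_boundedD (gauss_boundedZ a g2)
  (gauss_boundedZ b g1))).
by apply/funext => x; case: (f x) => u v /=; ring.
Qed.

Lemma cgauss_boundedD d (f g : 'rV[R]_d -> R[i]) : cgauss_bounded f ->
  cgauss_bounded g -> cgauss_bounded (fun x => f x + g x).
Proof.
move=> [f1 f2] [g1 g2]; split.
  apply: (eq_ind _ (@gauss_bounded R d) (gauss_boundedD f1 g1)).
  by apply/funext => x; case: (f x) (g x) => [u v] [u' v'].
apply: (eq_ind _ (@gauss_bounded R d) (gauss_boundedD f2 g2)).
by apply/funext => x; case: (f x) (g x) => [u v] [u' v'].
Qed.

Lemma cgauss_bounded_cexpi d (phi : 'rV[R]_d -> R) (f : 'rV[R]_d -> R[i]) :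
  measurable_fun setT phi -> cgauss_bounded f ->
  cgauss_bounded (fun x => cexpi (phi x) * f x).
Proof.
move=> mphi [g1 g2].
have C1 x : `|cos (phi x)| <= 1 by rewrite ler_norml cos_geN1 cos_le1.
have S1 x : `|sin (phi x)| <= 1 by rewrite ler_norml sin_geN1 sin_le1.
have mC := measurable_cos_comp mphi; have mS := measurable_sin_comp mphi.
split.
  apply: (eq_ind _ (@gauss_bounded R d) (gauss_boundedD (gauss_boundedM mC C1 g1)
    (gauss_boundedN (gauss_boundedM mS S1 g2)))).
  by apply/funext => x; case: (f x).
apply: (eq_ind _ (@gauss_bounded R d) (gauss_boundedD (gauss_boundedM mC C1 g2)
  (gauss_boundedM mS S1 g1))).
by apply/funext => x; case: (f x).
Qed.

Lemma cgauss_bounded_sum d I (r : seq I) (f : I -> 'rV[R]_d -> R[i]) :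
  (forall i, cgauss_bounded (f i)) -> cgauss_bounded (fun x => \sum_(i <- r) f i x).
Proof.
move=> gf; elim: r => [|i r IH].
  by under eq_fun do rewrite big_nil; split; exact: gauss_bounded0.
by under eq_fun do rewrite big_cons; exact: cgauss_boundedD.
Qed.

Lemma cintegralD d (f g : 'rV[R]_d -> R[i]) : cgauss_bounded f -> cgauss_bounded g ->
  cintegral (fun x => f x + g x) = cintegral f + cintegral g.
Proof.
move=> [f1 f2] [g1 g2]; rewrite /cintegral; simpc; congr Complex.
  rewrite -RintegralD//; try exact: gauss_bounded_integrable.
  by apply: eq_Rintegral => x _; case: (f x) (g x) => [u v] [u' v'].
rewrite -RintegralD//; try exact: gauss_bounded_integrable.
by apply: eq_Rintegral => x _; case: (f x) (g x) => [u v] [u' v'].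
Qed.

Lemma cintegralZ d (c : R[i]) (f : 'rV[R]_d -> R[i]) : cgauss_bounded f ->
  cintegral (fun x => c * f x) = c * cintegral f.
Proof.
case: c => a b [g1 g2]; rewrite /cintegral; simpc.
have i1 := gauss_bounded_integrable g1; have i2 := gauss_bounded_integrable g2.
have z1 k := gauss_bounded_integrable (gauss_boundedZ k g1).
have z2 k := gauss_bounded_integrable (gauss_boundedZ k g2).
congr Complex.
  rewrite -!RintegralZl// -RintegralB//; last exact: z2; last exact: z1.
  by apply: eq_Rintegral => x _; case: (f x).
rewrite -!RintegralZl// -RintegralD//; last exact: z1; last exact: z2.
by apply: eq_Rintegral => x _; case: (f x).
Qed.

Lemma cintegral_sum d I (r : seq I) (f : I -> 'rV[R]_d -> R[i]) :
  (forall i, cgauss_bounded (f i)) ->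
  cintegral (fun x => \sum_(i <- r) f i x) = \sum_(i <- r) cintegral (f i).
Proof.
move=> gf; elim: r => [|i r IH].
  rewrite big_nil (eq_cintegral (g := fun=> 0 * 0)); last first.
    by move=> x; rewrite big_nil mul0r.
  by rewrite cintegralZ ?mul0r//; split; exact: gauss_bounded0.
rewrite big_cons -IH -cintegralD//; last exact: cgauss_bounded_sum.
by apply: eq_cintegral => x; rewrite big_cons.
Qed.

Lemma cintegral_rotate n (f : 'rV[R]_(n + n) -> R[i]) : cgauss_bounded f ->
  cintegral f = cintegral (fun u => cintegral (fun w =>
    f (row_mx (2^-1 *: u + w) (2^-1 *: u - w)))).
Proof. by move=> [g1 g2]; congr Complex; exact: Rintegral_rotate. Qed.

Lemma cintegral_shift d (v : 'rV[R]_d) (f : 'rV[R]_d -> R[i]) : cgauss_bounded f ->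
  cintegral (fun x => f (v + x)) = cintegral f.
Proof.
move=> [[m1 _] [m2 _]]; congr Complex.
  exact: (Rintegral_rV_shift v m1).
exact: (Rintegral_rV_shift v m2).
Qed.

Lemma cgauss_bounded_gauss d (phi : 'rV[R]_d -> R) (c : R) :
  measurable_fun setT phi -> 0 < c ->
  cgauss_bounded (fun x => cexpi (phi x) * (expR (- c * dot x x))%:C%C).
Proof.
move=> mphi c0; apply: cgauss_bounded_cexpi => //.
exact/cgauss_bounded_real/gauss_bounded_gauss.
Qed.

Lemma cintegral_gauss d (a : 'rV[R]_d) (c : R) : 0 < c ->
  cintegral (fun x => cexpi (dot a x) * (expR (- c * dot x x))%:C%C) =
  (Num.sqrt (pi / c) ^+ d * expR (- dot a a / (4 * c)))%:C%C.
Proof.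
move=> c0; rewrite /cintegral; congr Complex.
  transitivity (\int[lebesgue_rV d]_x (cos (0 + dot a x) * expR (- c * dot x x))).
    by apply: eq_Rintegral => x _; rewrite add0r /=; ring.
  by rewrite Rintegral_cos_gauss_rV// cos0 mul1r.
(* The sine is the cosine with phase - pi / 2, and the value of that integral carries the factor cos
   (- pi / 2) = 0. *)
transitivity (\int[lebesgue_rV d]_x (cos (- (pi / 2) + dot a x) * expR (- c * dot x x))).
  apply: eq_Rintegral => x _ /=; rewrite mulr0 add0r; congr (_ * _).
  by rewrite cosD cosN sinN cos_pihalf sin_pihalf; ring.
by rewrite Rintegral_cos_gauss_rV// cosN cos_pihalf !mul0r.
Qed.

Lemma fourier_sum d I (r : seq I) (f : I -> 'rV[R]_d -> R[i]) xi :
  (forall i, cgauss_bounded (f i)) ->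
  fourier (fun x => \sum_(i <- r) f i x) xi = \sum_(i <- r) fourier (f i) xi.
Proof.
move=> gf; have mphi : measurable_fun setT (fun x : 'rV[R]_d => - dot x xi).
  by apply: measurableT_comp => //; exact: measurable_dot.
rewrite /fourier -mulr_sumr -cintegral_sum; last first.
  by move=> i; exact: cgauss_bounded_cexpi.
by congr (_ * _); apply: eq_cintegral => x; rewrite mulr_sumr.
Qed.

Lemma fourierZ d (c : R[i]) (f : 'rV[R]_d -> R[i]) xi : cgauss_bounded f ->
  fourier (fun x => c * f x) xi = c * fourier f xi.
Proof.
move=> gf; have mphi : measurable_fun setT (fun x : 'rV[R]_d => - dot x xi).
  by apply: measurableT_comp => //; exact: measurable_dot.
rewrite /fourier [RHS]mulrCA; congr (_ * _).
rewrite -cintegralZ; last exact: cgauss_bounded_cexpi.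
by apply: eq_cintegral => x; rewrite mulrCA.
Qed.

Lemma inv_fourier_sum d I (r : seq I) (f : I -> 'rV[R]_d -> R[i]) x :
  (forall i, cgauss_bounded (f i)) ->
  inv_fourier (fun xi => \sum_(i <- r) f i xi) x = \sum_(i <- r) inv_fourier (f i) x.
Proof.
move=> gf; have mphi : measurable_fun setT (fun xi : 'rV[R]_d => dot x xi).
  exact: measurable_dot.
rewrite /inv_fourier -mulr_sumr -cintegral_sum; last first.
  by move=> i; exact: cgauss_bounded_cexpi.
by congr (_ * _); apply: eq_cintegral => xi; rewrite mulr_sumr.
Qed.

Lemma inv_fourierZ d (c : R[i]) (f : 'rV[R]_d -> R[i]) x : cgauss_bounded f ->
  inv_fourier (fun xi => c * f xi) x = c * inv_fourier f x.
Proof.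
move=> gf; have mphi : measurable_fun setT (fun xi : 'rV[R]_d => dot x xi).
  exact: measurable_dot.
rewrite /inv_fourier [RHS]mulrCA; congr (_ * _).
rewrite -cintegralZ; last exact: cgauss_bounded_cexpi.
by apply: eq_cintegral => xi; rewrite mulrCA.
Qed.

(** Multiplying by the unimodular exp (- i x . m) does not change the modulus, which dominates the
    real part. The free [m] is later the point where f concentrates, so that the cosine stays near 1
    there. *)
Lemma cmod_inv_fourier_ge d (f : 'rV[R]_d -> R) (x m : 'rV[R]_d) : gauss_bounded f ->
  fourier_cst d * \int[lebesgue_rV d]_xi (cos (dot x (xi - m)) * f xi) <=
  cmod (inv_fourier (fun xi => (f xi)%:C%C) x).
Proof.
move=> gf; have mphi : measurable_fun setT (fun xi : 'rV[R]_d => dot x xi).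
  exact: measurable_dot.
have c0 : 0 <= fourier_cst d :> R by rewrite invr_ge0 exprn_ge0 ?sqrtr_ge0.
rewrite /inv_fourier cmodM cmod_real ger0_norm// ler_wpM2l//.
set z := cintegral _; have -> : cmod z = cmod (cexpi (- dot x m) * z).
  by rewrite cmodM cmod_cexpi mul1r.
apply: le_trans (Re_le_cmod _); rewrite /z -cintegralZ; last first.
  exact/cgauss_bounded_cexpi/cgauss_bounded_real.
rewrite le_eqVlt; apply/orP; left; apply/eqP.
apply: eq_Rintegral => xi _; rewrite mulrA -cexpiD dotDr dotNr addrC /=.
by rewrite mulr0 subr0.
Qed.

End complex_integral.

(** * Wave packets *)

Section wave_packet.
Context {R : realType}.
Implicit Types (n : nat).

(** With u = xi + eta and w = (xi - eta) / 2 one has |xi|^2 + |eta|^2 = |u|^2 / 2 + 2 |w|^2, so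
    decay in u - v and w is decay in (xi, eta). *)
Lemma gauss_bounded_quad n (v : 'rV[R]_n) (a b : R) : 0 < a -> 0 < b ->
  gauss_bounded (fun z : 'rV[R]_(n + n) =>
    expR (- (a * dot (lsubmx z + rsubmx z - v) (lsubmx z + rsubmx z - v) +
             b * dot (2^-1 *: (lsubmx z - rsubmx z)) (2^-1 *: (lsubmx z - rsubmx z))))).
Proof.
move=> a0 b0; set U := fun z : 'rV[R]_(n + n) => lsubmx z + rsubmx z - v.
set W := fun z : 'rV[R]_(n + n) => 2^-1 *: (lsubmx z - rsubmx z).
have mU : measurable_fun setT U.
  apply: measurable_vecD => //; apply: measurable_vecD; first exact: measurable_lsubmx.
  exact: measurable_rsubmx.
have mW : measurable_fun setT W.
  apply: measurable_vecZ; apply: measurable_vecD; first exact: measurable_lsubmx.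
  by apply: measurable_vecN; exact: measurable_rsubmx.
have c0 : 0 < Num.min a b by rewrite lt_min a0.
have g : gauss_bounded ((fun z : 'rV[R]_(n + n) => expR (- Num.min a b * dot z z)) \o
    (fun z => row_mx (U z) (W z))).
  apply: (gauss_bounded_comp (k := 2^-1) (b := dot v v)) => // [|z|].
  - exact: measurable_row_mx.
  - rewrite -{1 2}(hsubmxK z) !dot_row_mx /U /W.
    have := dot_sub_le (lsubmx z + rsubmx z - v) (- v); rewrite opprK subrK.
    have := dot_ge0 (lsubmx z + rsubmx z - v); have := dot_ge0 v.
    rewrite !dotE (dotC v (lsubmx z)) (dotC v (rsubmx z)) (dotC (rsubmx z) (lsubmx z)).
    lra.
  - exact: gauss_bounded_gauss.
apply: (gauss_bounded_le (M := 1)) g _.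
  apply: measurable_expR_comp; apply: measurableT_comp => //.
  by apply: measurable_funD; apply: measurable_funM => //; exact: measurable_dot.
move=> z; rewrite mul1r !ger0_norm ?expR_ge0// ler_expR /= dot_row_mx.
rewrite mulNr lerN2 mulrDr lerD// ler_wpM2r ?dot_ge0//.
  by rewrite ge_min lexx.
by rewrite ge_min lexx orbT.
Qed.

Lemma fourier_cst_gt0 d : 0 < fourier_cst d :> R.
Proof. by rewrite invr_gt0 exprn_gt0// sqrtr_gt0 mulr_gt0// pi_gt0. Qed.

Section packet.
Variables (n : nat) (A tau : R) (u0 : 'rV[R]_n).
Hypothesis A0 : 0 < A.

(** The variables X = x + y and Y = (x - y) / 2 are dual to u / 2 and 2 w. A Gaussian in X of rate S
    has transform exp (- |u - u0|^2 / (16 S)), which fixes S; the value of b makes S the rate in X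
    that remains after the integration over Y. *)
Let S := (16 * A)^-1.
Let b := (1 + 4 * S * tau ^+ 2)^-1.
Let S0 : 0 < S. Proof. by rewrite invr_gt0 mulr_gt0. Qed.
Let b0 : 0 < b.
Proof.
rewrite invr_gt0 (lt_le_trans ltr01)// lerDl mulr_ge0 ?sqr_ge0//.
by rewrite mulr_ge0// ltW.
Qed.

Definition packet_cst : R :=
  (fourier_cst (n + n) * (Num.sqrt (pi / b) ^+ n * Num.sqrt (pi / S) ^+ n))^-1.

(* A Gaussian centred at [u0] in the variable u = xi + eta, evolved for the
   time [- tau]; the constants are those for which [fourier_packet] holds. *)
Definition packet (x y : 'rV[R]_n) : R[i] :=
  packet_cst%:C%C *
  (cexpi (- (4 * b * S * tau) * dot (x + y) (2^-1 *: (x - y)) + 2^-1 * dot u0 (x + y)) *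
   (expR (- (b * S * dot (x + y) (x + y) + b * dot (2^-1 *: (x - y)) (2^-1 *: (x - y)))))%:C%C).

Definition packet_hat (zeta : 'rV[R]_(n + n)) : R[i] :=
  let u := lsubmx zeta + rsubmx zeta in
  let w := 2^-1 *: (lsubmx zeta - rsubmx zeta) in
  cexpi (tau * dot w (u - u0)) *
  (expR (- (A * dot (u - u0) (u - u0) + dot w w)))%:C%C.

Lemma cgauss_bounded_packet : cgauss_bounded (on_prod packet).
Proof.
apply: cgauss_boundedZ; apply: cgauss_bounded_cexpi.
  apply: measurable_funD; apply: measurable_funM => //; apply: measurable_dot => //.
  - by apply: measurable_vecD; [exact: measurable_lsubmx|exact: measurable_rsubmx].
  - apply: measurable_vecZ; apply: measurable_vecD; first exact: measurable_lsubmx.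
    by apply: measurable_vecN; exact: measurable_rsubmx.
  - by apply: measurable_vecD; [exact: measurable_lsubmx|exact: measurable_rsubmx].
apply: cgauss_bounded_real.
have := gauss_bounded_quad (0 : 'rV[R]_n) (mulr_gt0 b0 S0) b0.
by under eq_fun do rewrite subr0.
Qed.

Lemma cgauss_bounded_packet_hat : cgauss_bounded packet_hat.
Proof.
apply: cgauss_bounded_cexpi.
  apply: measurable_funM => //; apply: measurable_dot => //.
    apply: measurable_vecZ; apply: measurable_vecD; first exact: measurable_lsubmx.
    by apply: measurable_vecN; exact: measurable_rsubmx.
  apply: measurable_vecD => //.
  by apply: measurable_vecD; [exact: measurable_lsubmx|exact: measurable_rsubmx].
apply: cgauss_bounded_real.
have := gauss_bounded_quad u0 A0 ltr01.
by under eq_fun do rewrite mul1r.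
Qed.

Lemma half_sum (u w : 'rV[R]_n) : 2^-1 *: u + w + (2^-1 *: u - w) = u.
Proof. by apply/rowP => i; rewrite !mxE; field. Qed.

Lemma half_diff (u w : 'rV[R]_n) : 2^-1 *: (2^-1 *: u + w - (2^-1 *: u - w)) = w.
Proof. by apply/rowP => i; rewrite !mxE; field. Qed.

(** Two Gaussian integrations. The one over Y, after completing the square, leaves exp (- |w|^2) and
    a Gaussian in X centred at - 2 tau w; recentring it produces the phase tau w . (u - u0), and the
    one over X gives the decay in u - u0. *)
Lemma fourier_packet zeta : fourier (on_prod packet) zeta = packet_hat zeta.
Proof.
rewrite -(hsubmxK zeta); set xi := lsubmx zeta; set eta := rsubmx zeta.
rewrite /packet_hat row_mxKl row_mxKr.
set u := xi + eta; set w := 2^-1 *: (xi - eta).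
have xiE : xi = 2^-1 *: u + w by apply/rowP => i; rewrite !mxE; field.
have etaE : eta = 2^-1 *: u - w by apply/rowP => i; rewrite !mxE; field.
clearbody u w.
have gp : cgauss_bounded (fun x => cexpi (- dot x (row_mx xi eta)) * on_prod packet x).
  apply: cgauss_bounded_cexpi; last exact: cgauss_bounded_packet.
  by apply: measurableT_comp => //; exact: measurable_dot.
rewrite /fourier cintegral_rotate//.
pose k := Num.sqrt (pi / b) ^+ n.
pose v := (2 * tau) *: w; pose a := 2^-1 *: (u0 - u).
pose C := (packet_cst * k * expR (- dot w w))%:C%C * cexpi (tau * dot w (u - u0)).
pose G (X : 'rV[R]_n) := C * (cexpi (dot a X) * (expR (- S * dot X X))%:C%C).
have gG : cgauss_bounded G.
  by apply: cgauss_boundedZ; apply: cgauss_bounded_gauss => //; exact: measurable_dot.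
rewrite (eq_cintegral (g := fun X => G (v + X))); last first.
  move=> X; pose e := - (4 * b * S * tau) *: X - 2 *: w.
  rewrite (eq_cintegral (g := fun Y => (packet_cst%:C%C *
     (cexpi (dot a X) * (expR (- (b * S * dot X X)))%:C%C)) *
     (cexpi (dot e Y) * (expR (- b * dot Y Y))%:C%C))); last first.
    move=> Y; rewrite /on_prod row_mxKl row_mxKr /packet half_sum half_diff dot_row_mx.
    have -> : - (b * S * dot X X + b * dot Y Y) = - (b * S * dot X X) + - b * dot Y Y.
      by ring.
    rewrite expRD rmorphM /=.
    have E : cexpi (- (dot (2^-1 *: X + Y) xi + dot (2^-1 *: X - Y) eta)) *
       cexpi (- (4 * b * S * tau) * dot X Y + 2^-1 * dot u0 X) =
       cexpi (dot a X) * cexpi (dot e Y).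
      rewrite -!cexpiD; congr cexpi; rewrite /a /e {1}xiE {1}etaE !dotE.
      by rewrite (dotC X u) (dotC X w) (dotC Y u) (dotC Y w); field.
    set r1 := (expR _)%:C%C; set r2 := (expR _)%:C%C.
    move: E; set E1 := cexpi _; set E2 := cexpi _; set F1 := cexpi _; set F2 := cexpi _.
    move=> E; transitivity (packet_cst%:C%C * (E1 * E2) * (r1 * r2)); first by ring.
    by rewrite E; ring.
  rewrite cintegralZ ?cintegral_gauss//; last first.
    by apply: cgauss_bounded_gauss => //; exact: measurable_dot.
  rewrite /G /C -/k rmorphM /=.
  have -> : cexpi (dot a (v + X)) = cexpi (- (tau * dot w (u - u0))) * cexpi (dot a X).
    rewrite -cexpiD; congr cexpi; rewrite /a /v !dotE.
    by rewrite (dotC u0 w) (dotC u w); field.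
  have E : expR (- (b * S * dot X X)) * expR (- dot e e / (4 * b)) =
      expR (- dot w w) * expR (- S * dot (v + X) (v + X)).
    rewrite -!expRD; congr expR; rewrite /e /v !dotE (dotC X w) /b.
    by field; rewrite lt0r_neq0// -invr_gt0.
  set c1 := cexpi (tau * _); set c2 := cexpi (- _); set c3 := cexpi (dot a X).
  have c12 : c2 * c1 = 1 by exact: cexpiNK.
  have {}E := congr1 (fun r : R => r%:C%C) E; rewrite !rmorphM /= in E.
  rewrite !rmorphM /=.
  transitivity (packet_cst%:C%C * k%:C%C * c3 * ((expR (- (b * S * dot X X)))%:C%C *
     (expR (- dot e e / (4 * b)))%:C%C)); first by ring.
  rewrite E -[in LHS](mulr1 c3) -c12; ring.
rewrite cintegral_shift// cintegralZ ?cintegral_gauss//; last first.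
  by apply: cgauss_bounded_gauss => //; exact: measurable_dot.
have aE : - dot a a / (4 * S) = - (A * dot (u - u0) (u - u0)).
  rewrite /a /S !dotE (dotC u0 u); field; exact: lt0r_neq0.
rewrite aE /C opprD expRD.
have K : fourier_cst (n + n) * packet_cst * k * Num.sqrt (pi / S) ^+ n = 1.
  rewrite /packet_cst -/k; set q := _ ^+ n.
  have f0 := fourier_cst_gt0 (n + n).
  have q0 : 0 < q by rewrite exprn_gt0// sqrtr_gt0 divr_gt0// pi_gt0.
  have k0 : 0 < k by rewrite exprn_gt0// sqrtr_gt0 divr_gt0// pi_gt0.
  by field; rewrite !lt0r_neq0.
have {}K := congr1 (fun r : R => r%:C%C) K; rewrite !rmorphM /= rmorph1 in K.
rewrite !rmorphM /=.
rewrite -[RHS]mul1r -K rmorphXn/=; ring.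
Qed.

End packet.
End wave_packet.

(** * Fourier inversion for Gaussians *)

Section gauss_inversion.
Context {R : realType} (n : nat).

Section one.
Variables (S : R) (m : 'rV[R]_n).
Hypothesis S0 : 0 < S.

Let g (u : 'rV[R]_n) : R[i] := (expR (- S * dot (u - m) (u - m)))%:C%C.
Let ghat (x : 'rV[R]_n) : R[i] := (fourier_cst n * Num.sqrt (pi / S) ^+ n)%:C%C *
  (cexpi (dot m x) * (expR (- (4 * S)^-1 * dot x x))%:C%C).

Let S40 : 0 < (4 * S)^-1. Proof. by rewrite invr_gt0 mulr_gt0. Qed.

Lemma gauss_bounded_shifted_gauss :
  gauss_bounded (fun u : 'rV[R]_n => expR (- S * dot (u - m) (u - m))).
Proof.
have := gauss_bounded_shift (- m) (gauss_bounded_gauss n S0).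
by under eq_fun do rewrite addrC.
Qed.

Let gg : cgauss_bounded g.
Proof. exact/cgauss_bounded_real/gauss_bounded_shifted_gauss. Qed.

Lemma cgauss_bounded_inv_fourier_gauss : cgauss_bounded ghat.
Proof.
by apply: cgauss_boundedZ; apply: cgauss_bounded_gauss => //; exact: measurable_dot.
Qed.

Lemma inv_fourier_gauss x : inv_fourier g x = ghat x.
Proof.
have gx : cgauss_bounded (fun u => cexpi (dot x u) * g u).
  by apply: cgauss_bounded_cexpi => //; exact: measurable_dot.
rewrite /inv_fourier -(cintegral_shift m gx) /ghat.
rewrite (eq_cintegral (g := fun u => cexpi (dot m x) *
    (cexpi (dot x u) * (expR (- S * dot u u))%:C%C))); last first.
  move=> u; rewrite /g (_ : m + u - m = u); last by rewrite [m + u]addrC addrK.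
  by rewrite dotDr (dotC x m) cexpiD mulrA.
rewrite cintegralZ ?cintegral_gauss//; last first.
  by apply: cgauss_bounded_gauss => //; exact: measurable_dot.
rewrite (_ : - dot x x / (4 * S) = - (4 * S)^-1 * dot x x); last by ring.
rewrite !rmorphM /= rmorphXn/=; ring.
Qed.

Lemma gauss_inversion xi : fourier (inv_fourier g) xi = g xi.
Proof.
have -> : inv_fourier g = ghat by apply/funext => x; exact: inv_fourier_gauss.
rewrite fourierZ; last first.
  by apply: cgauss_bounded_gauss => //; exact: measurable_dot.
rewrite /fourier (eq_cintegral (g := fun x => cexpi (dot (m - xi) x) *
    (expR (- (4 * S)^-1 * dot x x))%:C%C)); last first.
  by move=> x; rewrite mulrA -cexpiD dotDl dotNl (dotC x xi) [X in cexpi X]addrC.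
rewrite cintegral_gauss// -!rmorphM /= /g; congr (_%:C)%C.
have -> : - dot (m - xi) (m - xi) / (4 * (4 * S)^-1) = - S * dot (xi - m) (xi - m).
  by rewrite !dotE (dotC m xi); field; exact: lt0r_neq0.
rewrite !mulrA -[RHS]mul1r; congr (_ * _).
have p0 : 0 < pi :> R := pi_gt0 R.
have -> : pi / (4 * S)^-1 = pi * 4 * S by field; exact: lt0r_neq0.
rewrite /fourier_cst -exprVn -!exprMn -[RHS](expr1n _ n); congr (_ ^+ n).
have -> : Num.sqrt (pi * 4 * S) = 2 * Num.sqrt pi * Num.sqrt S.
  rewrite sqrtrM ?mulr_ge0 ?ltW// sqrtrM ?ltW// (_ : 4 = 2 ^+ 2) ?sqrtr_sqr; last by ring.
  by rewrite ger0_norm// [_ * 2]mulrC.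
rewrite (sqrtrM _ (ler0n _ 2)) (sqrtrM _ (ltW p0)) sqrtrV ?ltW//.
have s2 : Num.sqrt (2 : R) ^+ 2 = 2 by rewrite sqr_sqrtr.
have sp : 0 < Num.sqrt (pi : R) by rewrite sqrtr_gt0.
have sS : 0 < Num.sqrt S by rewrite sqrtr_gt0.
have s20 : 0 < Num.sqrt (2 : R) by rewrite sqrtr_gt0.
rewrite -[X in _ * (X * _ * _)]s2.
by field; rewrite !lt0r_neq0.
Qed.

End one.
End gauss_inversion.

(** From ln r <= r and alpha r <= alpha^2 / (4 c) + c r^2. An arbitrarily small Gaussian rate thus
    absorbs any power of |xi|. *)
Lemma powR_le_expR {R : realType} (alpha c r : R) : 0 <= alpha -> 0 < c -> 0 <= r ->
  r `^ alpha <= expR (alpha ^+ 2 / (4 * c)) * expR (c * r ^+ 2).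
Proof.
move=> a0 c0; rewrite -expRD le_eqVlt => /predU1P[<-|r0].
  (* At r = 0 the power is 1 if alpha = 0 and 0 otherwise. *)
  rewrite expr0n/= mulr0 addr0 (@le_trans _ _ 1)//.
    by rewrite /powR eqxx lern1 leq_b1.
  by rewrite -[leLHS]expR0 ler_expR divr_ge0 ?sqr_ge0// mulr_ge0// ltW.
rewrite /powR gt_eqF// ler_expR.
have ln_le : ln r <= r.
  have h : -1 < r - 1 by lra.
  have := le_ln1Dx h; rewrite (_ : 1 + (r - 1) = r); last by ring.
  by move/le_trans; apply; lra.
rewrite (le_trans (ler_wpM2l a0 ln_le))//.
have -> : alpha ^+ 2 / (4 * c) + c * r ^+ 2 = alpha * r + c * (r - alpha / (2 * c)) ^+ 2.
  by field; exact: lt0r_neq0.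
by rewrite lerDl mulr_ge0 ?sqr_ge0// ltW.
Qed.

Lemma gauss_bounded_powR {R : realType} d (alpha : R) (g : 'rV[R]_d -> R) :
  0 <= alpha -> gauss_bounded g -> gauss_bounded (fun xi => enorm xi `^ alpha * g xi).
Proof.
move=> a0 [mh [C [c [c0 hC]]]]; split.
  apply: measurable_funM => //.
  by apply: (measurableT_comp (measurable_powR alpha)); exact: measurable_enorm.
have c20 : 0 < c / 2 by rewrite divr_gt0.
exists (expR (alpha ^+ 2 / (4 * (c / 2))) * C), (c / 2); split=> // xi.
rewrite normrM ger0_norm ?powR_ge0//.
rewrite (le_trans (ler_pM (powR_ge0 _ _) (normr_ge0 _)
  (powR_le_expR a0 c20 (enorm_ge0 xi)) (hC xi)))//.
rewrite enormK mulrACA -[leRHS]mulrA -mulrA ler_wpM2l ?expR_ge0//.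
by rewrite -expRD (_ : c / 2 * _ + _ = - (c / 2) * dot xi xi)//; field.
Qed.

Lemma gauss_bounded_dot {R : realType} d (u0 : 'rV[R]_d) (g : 'rV[R]_d -> R) :
  gauss_bounded g -> gauss_bounded (fun u => dot (u - u0) (u - u0) * g u).
Proof.
move=> [mg [C [c [c0 gC]]]]; split.
  by apply: measurable_funM => //; apply: measurable_dot; exact: measurable_vecD.
exists ((4 / c + 2 * dot u0 u0) * `|C|), (c / 2); split=> [|u]; first exact: divr_gt0.
have E0 := expR_ge0 (c / 2 * dot u u).
have h : dot (u - u0) (u - u0) <= (4 / c + 2 * dot u0 u0) * expR (c / 2 * dot u u).
  rewrite (le_trans (dot_sub_le u u0))// [leRHS]mulrDl lerD//.
    rewrite (_ : 2 * dot u u = 4 / c * (c / 2 * dot u u)); last first.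
      by field; exact: lt0r_neq0.
    rewrite ler_wpM2l ?divr_ge0 ?(ltW c0)// (le_trans _ (expR_ge1Dx _))//.
    by rewrite lerDr.
  rewrite ler_peMr ?mulr_ge0 ?dot_ge0// (le_trans _ (expR_ge1Dx _))// lerDl.
  by rewrite mulr_ge0 ?dot_ge0// divr_ge0// ltW.
rewrite normrM ger0_norm ?dot_ge0//.
have gC' : `|g u| <= `|C| * expR (- c * dot u u).
  by rewrite (le_trans (gC u))// ler_wpM2r ?expR_ge0// ler_norm.
rewrite (le_trans (ler_pM (dot_ge0 _) (normr_ge0 _) h gC'))// mulrACA.
by rewrite -expRD (_ : c / 2 * _ + _ = - (c / 2) * dot u u)//; field.
Qed.

(** * Superpositions of packets and their density *)

Section superposition.
Context {R : realType} (n N : nat) (A : R) (tau : 'I_N -> R) (u0 : 'rV[R]_n).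
Hypothesis A0 : 0 < A.

Definition packets (x y : 'rV[R]_n) : R[i] := \sum_(j < N) packet A (tau j) u0 x y.

(** Up to [diag_cst], the Fourier transform of the density at time t. In the integral over w the
    phase is linear with covector tau (u - u0) - t u, and transforming exp (- |w|^2) at this
    covector gives the quarter of its square. *)
Definition density_hat (t : R) (u : 'rV[R]_n) : R :=
  \sum_(j < N) expR (- (A * dot (u - u0) (u - u0) +
    dot (tau j *: (u - u0) - t *: u) (tau j *: (u - u0) - t *: u) / 4)).

Lemma fourier_packets zeta :
  fourier (on_prod packets) zeta = \sum_(j < N) packet_hat A (tau j) u0 zeta.
Proof.
rewrite fourier_sum; last by move=> j; exact: cgauss_bounded_packet.
by apply: eq_bigr => j _; rewrite fourier_packet.
Qed.

(** Completing the square in u, where tau (u - u0) - t u = (tau - t) u - tau u0. The rate is S = A +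
    (tau - t)^2 / 4, and the maximum lies at a multiple of u0. In this form [gauss_inversion]
    applies to each term. *)
Lemma density_hat_gauss t (j : 'I_N) : exists K S m, 0 < S /\ forall u,
  expR (- (A * dot (u - u0) (u - u0) +
    dot (tau j *: (u - u0) - t *: u) (tau j *: (u - u0) - t *: u) / 4)) =
  K * expR (- S * dot (u - m) (u - m)).
Proof.
pose S := A + (tau j - t) ^+ 2 / 4.
have S0 : 0 < S by rewrite ltr_wpDr// divr_ge0// sqr_ge0.
pose k := (A + (tau j - t) * tau j / 4) / S; pose m := k *: u0.
exists (expR (S * dot m m - (A + tau j ^+ 2 / 4) * dot u0 u0)), S, m; split=> // u.
rewrite -expRD; congr expR; rewrite /m !dotE (dotC u0 u).
have kE : S * k = A + (tau j - t) * tau j / 4 by rewrite /k mulrC mulfVK// lt0r_neq0.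
transitivity (- S * dot u u + 2 * (A + (tau j - t) * tau j / 4) * dot u u0
   - (A + tau j ^+ 2 / 4) * dot u0 u0); first by rewrite /S; field.
by rewrite -kE; ring.
Qed.

Lemma gauss_bounded_density_hat t : gauss_bounded (density_hat t).
Proof.
apply: gauss_bounded_sum => j; have [K [S [m [S0 E]]]] := density_hat_gauss t j.
rewrite (funext E); apply: gauss_boundedZ; exact: gauss_bounded_shifted_gauss.
Qed.

Lemma density_hat_ge0 t u : 0 <= density_hat t u.
Proof. by apply: sumr_ge0 => j _; exact: expR_ge0. Qed.

Lemma density_hat_inversion t :
  cgauss_bounded (inv_fourier (fun u => (density_hat t u)%:C%C)) /\
  forall xi, fourier (inv_fourier (fun u => (density_hat t u)%:C%C)) xi =
    (density_hat t xi)%:C%C.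
Proof.
pose h j u : R := expR (- (A * dot (u - u0) (u - u0) +
    dot (tau j *: (u - u0) - t *: u) (tau j *: (u - u0) - t *: u) / 4)).
have gh j : cgauss_bounded (fun u => (h j u)%:C%C).
  have [K [S [m [S0 E]]]] := density_hat_gauss t j.
  apply: cgauss_bounded_real; rewrite /h (funext E); apply: gauss_boundedZ.
  exact: gauss_bounded_shifted_gauss.
have E : (fun u => (density_hat t u)%:C%C) = (fun u => \sum_(j < N) (h j u)%:C%C).
  by apply/funext => u; rewrite /density_hat rmorph_sum.
rewrite {}E (_ : inv_fourier _ = fun x => \sum_(j < N) inv_fourier (fun u => (h j u)%:C%C) x).
  have H j : cgauss_bounded (inv_fourier (fun u => (h j u)%:C%C)) /\
      forall xi, fourier (inv_fourier (fun u => (h j u)%:C%C)) xi = (h j xi)%:C%C.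
    have [K [S [m [S0 E]]]] := density_hat_gauss t j.
    have -> : (fun u => (h j u)%:C%C) =
        (fun u => K%:C%C * (expR (- S * dot (u - m) (u - m)))%:C%C).
      by apply/funext => u; rewrite /h E rmorphM.
    have gS := cgauss_bounded_real (gauss_bounded_shifted_gauss m S0).
    rewrite (_ : inv_fourier _ = fun x => K%:C%C *
      inv_fourier (fun u => (expR (- S * dot (u - m) (u - m)))%:C%C) x); last first.
      by apply/funext => x; rewrite inv_fourierZ.
    have gi : cgauss_bounded (inv_fourier (fun u => (expR (- S * dot (u - m) (u - m)))%:C%C)).
      have := cgauss_bounded_inv_fourier_gauss m S0.
      by congr cgauss_bounded; apply/funext => x; rewrite inv_fourier_gauss.
    split=> [|xi]; first exact: cgauss_boundedZ.
    by rewrite fourierZ// gauss_inversion// /h E rmorphM.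
  split=> [|xi]; first by apply: cgauss_bounded_sum => j; case: (H j).
  rewrite fourier_sum; last by move=> j; case: (H j).
  by rewrite /density_hat rmorph_sum; apply: eq_bigr => j _; case: (H j).
by apply/funext => x; rewrite inv_fourier_sum.
Qed.

(** The integral over w contributes [Num.sqrt pi ^+ n]; the quotient passes from the normalization
    on R^(2n) to the one on R^n. *)
Definition diag_cst : R := fourier_cst (n + n) * Num.sqrt pi ^+ n / fourier_cst n.

Lemma diag_cst_gt0 : 0 < diag_cst.
Proof.
rewrite divr_gt0 ?fourier_cst_gt0// mulr_gt0 ?fourier_cst_gt0// exprn_gt0//.
by rewrite sqrtr_gt0 pi_gt0.
Qed.

(* |xi|^2 - |eta|^2 = 2 u . w is linear in [w], so the integral over [w] is the
   Fourier transform of a Gaussian evaluated at a point linear in [u]. *)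
Lemma propagator_diag t x : propagator t packets x x =
  diag_cst%:C%C * inv_fourier (fun u => (density_hat t u)%:C%C) x.
Proof.
rewrite /propagator /fourier_multiplier {1}/inv_fourier.
pose phi (z : 'rV[R]_(n + n)) := dot (row_mx x x) z +
  - (t * (enorm (lsubmx z) ^+ 2 - enorm (rsubmx z) ^+ 2) / 2).
have mphi : measurable_fun setT phi.
  apply: measurable_funD; first exact: measurable_dot.
  apply: measurableT_comp => //; apply: measurable_funM => //; apply: measurable_funM => //.
  apply: measurable_funB; apply: measurable_funX; apply: measurable_enorm.
    exact: measurable_lsubmx.
  exact: measurable_rsubmx.
have gj j : cgauss_bounded (fun z => cexpi (phi z) * packet_hat A (tau j) u0 z).
  by apply: cgauss_bounded_cexpi => //; exact: cgauss_bounded_packet_hat.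
rewrite (eq_cintegral (g := fun z => \sum_(j < N)
    (cexpi (phi z) * packet_hat A (tau j) u0 z))); last first.
  by move=> z; rewrite fourier_packets mulrA -cexpiD mulr_sumr.
rewrite cintegral_sum//.
pose h j u : R := expR (- (A * dot (u - u0) (u - u0) +
    dot (tau j *: (u - u0) - t *: u) (tau j *: (u - u0) - t *: u) / 4)).
have gh j : cgauss_bounded (fun u => (h j u)%:C%C).
  have [K [S [m [S0 E]]]] := density_hat_gauss t j.
  apply: cgauss_bounded_real; rewrite /h (funext E); apply: gauss_boundedZ.
  exact: gauss_bounded_shifted_gauss.
have gxh j : cgauss_bounded (fun u => cexpi (dot x u) * (h j u)%:C%C).
  by apply: cgauss_bounded_cexpi => //; exact: measurable_dot.
rewrite [inv_fourier _ x](_ : _ = (fourier_cst n)%:C%C *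
    \sum_(j < N) cintegral (fun u => cexpi (dot x u) * (h j u)%:C%C)); last first.
  rewrite /inv_fourier -cintegral_sum//; congr (_ * _); apply: eq_cintegral => u.
  by rewrite /density_hat rmorph_sum mulr_sumr.
rewrite mulrA -rmorphM /= /diag_cst mulfVK ?lt0r_neq0 ?fourier_cst_gt0//.
rewrite rmorphM /= -mulrA; congr (_ * _); rewrite mulr_sumr; apply: eq_bigr => j _.
rewrite cintegral_rotate// -cintegralZ//; apply: eq_cintegral => u.
pose a := tau j *: (u - u0) - t *: u.
rewrite (eq_cintegral (g := fun w => (cexpi (dot x u) *
    (expR (- (A * dot (u - u0) (u - u0))))%:C%C) *
    (cexpi (dot a w) * (expR (- 1 * dot w w))%:C%C))); last first.
  move=> w; rewrite /packet_hat row_mxKl row_mxKr half_sum half_diff opprD expRD.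
  rewrite rmorphM /= mulrA -cexpiD mulN1r.
  rewrite (_ : phi _ + _ = dot x u + dot a w); first by rewrite cexpiD; ring.
  rewrite /phi row_mxKl row_mxKr dot_row_mx !enormK /a !dotE.
  by rewrite !(dotC w) (dotC u w); field.
rewrite cintegralZ ?cintegral_gauss//; last first.
  by apply: cgauss_bounded_gauss => //; exact: measurable_dot.
rewrite divr1 mulr1 /h -/a opprD expRD !rmorphM /= rmorphXn /= mulNr; ring.
Qed.

Lemma abs_nabla_diag t alpha x : abs_nabla alpha (fun x => propagator t packets x x) x =
  inv_fourier (fun xi => (diag_cst * (enorm xi `^ alpha * density_hat t xi))%:C%C) x.
Proof.
have [gh hE] := density_hat_inversion t.
apply: (congr1 (fun F => inv_fourier F x)); apply/funext => xi.
rewrite (_ : (fun x => _) = fun x => diag_cst%:C%C *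
  inv_fourier (fun u => (density_hat t u)%:C%C) x); last first.
  by apply/funext => y; exact: propagator_diag.
by rewrite fourierZ// hE !rmorphM /= mulrCA.
Qed.

Lemma cmod_abs_nabla_ge t alpha x : 0 <= alpha ->
  diag_cst * fourier_cst n * \int[lebesgue_rV n]_xi
    (cos (dot x (xi - u0)) * (enorm xi `^ alpha * density_hat t xi)) <=
  cmod (abs_nabla alpha (fun x => propagator t packets x x) x).
Proof.
move=> a0; have g := gauss_bounded_powR a0 (gauss_bounded_density_hat t).
rewrite abs_nabla_diag; apply: le_trans (cmod_inv_fourier_ge x u0 (gauss_boundedZ diag_cst g)).
rewrite [diag_cst * _]mulrC -mulrA ler_wpM2l ?(ltW (fourier_cst_gt0 _))//.
rewrite -RintegralZl//; last first.
  apply/gauss_bounded_integrable/(gauss_boundedM (M := 1)) => //.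
    apply: measurable_cos_comp; apply: measurable_dot => //.
    exact: measurable_vecD.
  by move=> xi; rewrite ler_norml cos_geN1 cos_le1.
rewrite le_eqVlt; apply/orP; left; apply/eqP.
by apply: eq_Rintegral => xi _; rewrite mulrCA.
Qed.

End superposition.

(** * Sobolev norm of a superposition of packets *)

Section sobolev.
Context {R : realType}.
Implicit Types (n N : nat).

Lemma sum_cexpi_sqr (I : finType) (th : I -> R) :
  cmod (\sum_j cexpi (th j)) ^+ 2 = \sum_j \sum_k cos (th j - th k).
Proof.
have -> : \sum_j cexpi (th j) = Complex (\sum_j cos (th j)) (\sum_j sin (th j)).
  by apply/eqP; rewrite eq_complex/= !raddf_sum/= !eqxx.
rewrite /cmod /= sqr_sqrtr ?addr_ge0 ?sqr_ge0// !expr2 !mulr_suml -big_split/=.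
apply: eq_bigr => j _; rewrite !mulr_sumr -big_split/=; apply: eq_bigr => k _.
by rewrite cosB.
Qed.

Lemma powR_le_expR_lin (s c y : R) : 0 <= s -> 0 < c -> 0 <= y ->
  y `^ s <= expR ((2 * s) ^+ 2 / (4 * c)) * expR (c * y).
Proof.
move=> s0 c0 y0; have := @powR_le_expR R (2 * s) c (Num.sqrt y) _ c0 (sqrtr_ge0 y).
by rewrite sqr_sqrtr// powRrM powR_mulrn ?sqrtr_ge0// sqr_sqrtr//; apply; rewrite mulr_ge0.
Qed.

Section packets_norm.
Variables (n : nat) (s : R) (u0 : 'rV[R]_n).
Hypothesis s0 : 0 <= s.

Let U (z : 'rV[R]_(n + n)) := lsubmx z + rsubmx z - u0.
Let W (z : 'rV[R]_(n + n)) := 2^-1 *: (lsubmx z - rsubmx z).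

Let mU : measurable_fun setT U.
Proof.
apply: measurable_vecD => //; apply: measurable_vecD; first exact: measurable_lsubmx.
exact: measurable_rsubmx.
Qed.

Let mW : measurable_fun setT W.
Proof.
apply: measurable_vecZ; apply: measurable_vecD; first exact: measurable_lsubmx.
by apply: measurable_vecN; exact: measurable_rsubmx.
Qed.

Lemma gauss_bounded_cos_packet (A tau : R) : 0 < A ->
  gauss_bounded (fun z => cos (tau * dot (W z) (U z)) *
    expR (- (A * dot (U z) (U z) + dot (W z) (W z)))).
Proof.
move=> A0; apply: (gauss_boundedM (M := 1)).
- by apply: measurable_cos_comp; apply: measurable_funM => //; exact: measurable_dot.
- by move=> z; rewrite ler_norml cos_geN1 cos_le1.
- have := gauss_bounded_quad u0 A0 (@ltr01 R).
  by under eq_fun do rewrite mul1r.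
Qed.

(** The source of almost orthogonality: integrating the oscillation in w yields exp (- tau^2 |u -
    u0|^2 / 4), which narrows the Gaussian in u, so the value decays like |tau|^(-n). *)
Lemma Rintegral_cos_packet (A tau : R) : 0 < A ->
  \int[lebesgue_rV (n + n)]_z (cos (tau * dot (W z) (U z)) *
    expR (- (A * dot (U z) (U z) + dot (W z) (W z)))) =
  Num.sqrt pi ^+ n * Num.sqrt (pi / (A + tau ^+ 2 / 4)) ^+ n.
Proof.
move=> A0; rewrite Rintegral_rotate; last exact: gauss_bounded_cos_packet.
have c0 : 0 < A + tau ^+ 2 / 4 by rewrite ltr_wpDr// divr_ge0// sqr_ge0.
transitivity (\int[lebesgue_rV n]_u (Num.sqrt pi ^+ n *
    expR (- (A + tau ^+ 2 / 4) * dot (- u0 + u) (- u0 + u)))).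
  apply: eq_Rintegral => u _.
  transitivity (\int[lebesgue_rV n]_w (expR (- (A * dot (u - u0) (u - u0))) *
     (cos (0 + dot (tau *: (u - u0)) w) * expR (- 1 * dot w w)))).
    apply: eq_Rintegral => w _; rewrite /U /W row_mxKl row_mxKr half_sum half_diff.
    by rewrite add0r opprD expRD dotZl (dotC w) mulN1r; ring.
  rewrite RintegralZl//; last first.
    apply/gauss_bounded_integrable/(gauss_boundedM (M := 1)).
    - by apply: measurable_cos_comp; apply: measurable_funD => //; exact: measurable_dot.
    - by move=> z; rewrite ler_norml cos_geN1 cos_le1.
    - exact: gauss_bounded_gauss.
  rewrite Rintegral_cos_gauss_rV// cos0 mul1r divr1 mulrCA -expRD addrC [- u0 + _]addrC.
  by congr (_ * expR _); rewrite dotZl dotZr; field.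
rewrite RintegralZl//; last first.
  apply: gauss_bounded_integrable.
  exact: (gauss_bounded_shift (- u0) (gauss_bounded_gauss n c0)).
rewrite (Rintegral_rV_shift (- u0) (measurable_gauss_rV (A + tau ^+ 2 / 4))).
by rewrite /Rintegral integral_gauss_rV.
Qed.

Definition sobolev_cst : R :=
  expR ((2 * s) ^+ 2 / (4 * 2^-1)) * expR (2^-1 * (1 + dot u0 u0)).

(** A power of y = 1 + |z|^2 is at most a constant times exp (y / 2), and |z|^2 <= |U|^2 + |u0|^2 +
    2 |W|^2. The rate 1/2 keeps the growth within half of the decay of a squared packet with A >=
    1. *)
Lemma weight_le (z : 'rV[R]_(n + n)) :
  (1 + enorm z ^+ 2) `^ s <= sobolev_cst * expR (dot (U z) (U z) + dot (W z) (W z)).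
Proof.
rewrite (le_trans (powR_le_expR_lin s0 (_ : 0 < 2^-1) _))//.
  by rewrite addr_ge0// sqr_ge0.
rewrite /sobolev_cst -mulrA ler_wpM2l ?expR_ge0// -expRD ler_expR enormK.
rewrite -{1 2}(hsubmxK z) dot_row_mx.
have := dot_sub_le (U z) (- u0); have := dot_ge0 (U z); rewrite /U opprK subrK.
move: (dot (_ - u0) _) => D; rewrite /W !dotE (dotC (rsubmx z) (lsubmx z)); lra.
Qed.

(** The packets share one Gaussian modulus, so the squared transform of the sum is exp (- 2 (A |U|^2
    + |W|^2)) times D, the squared modulus of a sum of phases. As D >= 0, the weight can be bounded
    before D is expanded into cosines; each remaining integral is then explicit. *)
Lemma sobolev_packets_le N (A : R) (tau : 'I_N -> R) : 1 <= A ->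
  (sobolev_norm s (on_prod (packets A tau u0)) <=
   (Num.sqrt (sobolev_cst * \sum_j \sum_k
     (Num.sqrt pi ^+ n * Num.sqrt (pi / (A + (tau j - tau k) ^+ 2 / 4)) ^+ n)))%:E)%E.
Proof.
move=> A1; have A0 : 0 < A by rewrite (lt_le_trans ltr01).
pose D z := \sum_j \sum_k cos ((tau j - tau k) * dot (W z) (U z)).
have DE z : D z = cmod (\sum_j cexpi (tau j * dot (W z) (U z))) ^+ 2.
  rewrite sum_cexpi_sqr; apply: eq_bigr => j _; apply: eq_bigr => k _.
  by rewrite mulrBl.
have mD : measurable_fun setT D.
  apply: measurable_sum => j; apply: measurable_sum => k; apply: measurable_cos_comp.
  by apply: measurable_funM => //; exact: measurable_dot.
pose Q (B : R) z := expR (- (B * dot (U z) (U z) + dot (W z) (W z))).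
pose f z := (1 + enorm z ^+ 2) `^ s *
  (expR (- (2 * (A * dot (U z) (U z) + dot (W z) (W z)))) * D z).
pose g z := sobolev_cst * \sum_j \sum_k (cos ((tau j - tau k) * dot (W z) (U z)) * Q A z).
have gg : gauss_bounded g.
  apply: gauss_boundedZ; apply: gauss_bounded_sum => j; apply: gauss_bounded_sum => k.
  exact: gauss_bounded_cos_packet.
have fE z : `|((1 + enorm z ^+ 2) `^ (s / 2) *
    cmod (fourier (on_prod (packets A tau u0)) z))| ^+ 2 = f z.
  rewrite ger0_norm ?mulr_ge0 ?powR_ge0 ?sqrtr_ge0//.
  have wE (r : R) : (r `^ (s / 2)) ^+ 2 = r `^ s.
    by rewrite -powR_mulrn ?powR_ge0// -powRrM mulfVK.
  rewrite exprMn wE fourier_packets// /f.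
  congr (_ * _); rewrite /packet_hat -mulr_suml cmodM cmod_real exprMn DE mulrC.
  congr (_ * _); rewrite ger0_norm ?expR_ge0// expr2 -expRD; congr expR.
  by rewrite /U /W; ring.
have fg z : f z <= g z.
  rewrite /f /g (_ : \sum_j _ = D z * Q A z); last first.
    by rewrite /D mulr_suml; apply: eq_bigr => j _; rewrite mulr_suml.
  rewrite [D z * _]mulrC !mulrA ler_wpM2r ?DE ?sqr_ge0//.
  rewrite (le_trans (ler_wpM2r (expR_ge0 _) (weight_le z)))//.
  rewrite -mulrA ler_wpM2l ?mulr_ge0 ?expR_ge0// -expRD ler_expR.
  have := dot_ge0 (U z); have := dot_ge0 (W z); nra.
have f0 z : 0 <= f z by rewrite -fE sqr_ge0.
have mf : measurable_fun setT f.
  apply: measurable_funM.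
    apply: (measurableT_comp (measurable_powR s)); apply: measurable_funD => //.
    by apply: measurable_funX; exact: measurable_enorm.
  apply: measurable_funM => //; apply: measurable_expR_comp; apply: measurableT_comp => //.
  apply: measurable_funM => //; apply: measurable_funD; last exact: measurable_dot.
  by apply: measurable_funM => //; exact: measurable_dot.
have ig := gauss_bounded_integrable gg.
have Ig : (\int[lebesgue_rV (n + n)]_z (g z)%:E = (sobolev_cst * \sum_j \sum_k
     (Num.sqrt pi ^+ n * Num.sqrt (pi / (A + (tau j - tau k) ^+ 2 / 4)) ^+ n))%:E)%E.
  rewrite -[LHS]fineK; last exact: integrable_fin_num.
  congr EFin; rewrite -/(Rintegral _ _ _) RintegralZl//; last first.
    apply: gauss_bounded_integrable; apply: gauss_bounded_sum => j.
    by apply: gauss_bounded_sum => k; exact: gauss_bounded_cos_packet.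
  congr (_ * _); rewrite Rintegral_rV_sum; last first.
    by move=> j; apply: gauss_bounded_sum => k; exact: gauss_bounded_cos_packet.
  apply: eq_bigr => j _; rewrite Rintegral_rV_sum; last first.
    by move=> k; exact: gauss_bounded_cos_packet.
  by apply: eq_bigr => k _; rewrite Rintegral_cos_packet.
rewrite /sobolev_norm unlock.
under eq_integral do rewrite abse_EFin poweR_EFin powR_mulrn// fE.
have le1 : (\int[lebesgue_rV (n + n)]_z (f z)%:E <= \int[lebesgue_rV (n + n)]_z (g z)%:E)%E.
  apply: ge0_le_integral => //.
  - by move=> z _; rewrite lee_fin.
  - exact/measurable_EFinP.
  - by apply/measurable_EFinP; case: gg.
  - by move=> z _; rewrite lee_fin.
rewrite Ig in le1.
have If0 : (0 <= \int[lebesgue_rV (n + n)]_z (f z)%:E)%E.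
  by apply: integral_ge0 => z _; rewrite lee_fin.
have V0 := le_trans If0 le1; rewrite lee_fin in V0.
rewrite -powR12_sqrt// -poweR_EFin; apply: gt0_ler_poweR => //.
- by rewrite in_itv/= If0 leey.
- by rewrite in_itv/= lee_fin V0 leey.
Qed.

End packets_norm.
End sobolev.

(** * Packets are Schwartz functions *)

Section schwartz_class.
Context {R : realType}.
Implicit Types (d : nat).

Lemma coord_le_enorm d (x : 'rV[R]_d) i : `|x 0 i| <= enorm x.
Proof.
rewrite -sqrtr_sqr ler_wsqrtr// /dot (bigD1 i)//= -expr2 lerDl.
by apply: sumr_ge0 => j _; rewrite -expr2 sqr_ge0.
Qed.

Lemma derive_coord d (x v : 'rV[R]_d) i : 'D_v (fun y : 'rV[R]_d => y 0 i) x = v 0 i.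
Proof.
have @f : {linear 'rV[R]_d -> R}.
  by exists (fun N : 'rV[R]_d => N 0 i); do 2![eexists]; do ?[constructor];
     rewrite ?mxE// => ? *; rewrite ?mxE//; move=> ?; rewrite !mxE.
rewrite deriveE; last exact: differentiable_coord.
by rewrite (_ : (fun _ => _) = f)// diff_lin//; exact: coord_continuous.
Qed.

Lemma derive_comp1 d (f : 'rV[R]_d -> R) (g : R -> R) (x v : 'rV[R]_d) (dg : R) :
  differentiable f x -> is_derive (f x) 1 g dg ->
  differentiable (fun y => g (f y)) x /\
  'D_v (fun y => g (f y)) x = 'D_v f x * dg.
Proof.
move=> df hg; have dgx : differentiable g (f x) by apply/derivable1_diffP; exact: ex_derive.
have dc := differentiable_comp df dgx; split=> //.
rewrite !deriveE// -/(g \o f) (diff_comp df dgx) /= diff1E//= derive1E derive_val.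
by rewrite /GRing.scale.
Qed.

Lemma derive_mulR d (f g : 'rV[R]_d -> R) (x v : 'rV[R]_d) :
  differentiable f x -> differentiable g x ->
  'D_v (fun y => f y * g y) x = 'D_v f x * g x + f x * 'D_v g x.
Proof.
move=> df dg; have := @deriveM R _ f g x v (diff_derivable df) (diff_derivable dg).
by move=> E; rewrite [LHS]E /GRing.scale/= addrC (mulrC (g x)).
Qed.

(** Polynomial functions, given by their construction so that differentiability, closure under
    derivatives and polynomial growth are inductions. *)
Inductive poly_fun d : ('rV[R]_d -> R) -> Prop :=
| poly_cst c : poly_fun (fun=> c)
| poly_coord i : poly_fun (fun x => x 0 i)
| poly_add p q : poly_fun p -> poly_fun q -> poly_fun (fun x => p x + q x)
| poly_mul p q : poly_fun p -> poly_fun q -> poly_fun (fun x => p x * q x).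

Lemma poly_differentiable d (p : 'rV[R]_d -> R) : poly_fun p -> forall x, differentiable p x.
Proof.
elim=> [c|i|p1 q1 _ IHp _ IHq|p1 q1 _ IHp _ IHq] x.
- exact: differentiable_cst.
- exact: differentiable_coord.
- exact: differentiableD.
- exact: differentiableM.
Qed.

Lemma poly_derive d (p : 'rV[R]_d -> R) v : poly_fun p -> poly_fun ('D_v p).
Proof.
elim=> [c|i|p1 q1 pp IHp pq IHq|p1 q1 pp IHp pq IHq].
- rewrite (_ : 'D_v _ = fun=> 0); first exact: poly_cst.
  by apply/funext => x; exact: derive_cst.
- rewrite (_ : 'D_v _ = fun=> v 0 i); first exact: poly_cst.
  by apply/funext => x; exact: derive_coord.
- rewrite (_ : 'D_v _ = fun x => 'D_v p1 x + 'D_v q1 x); first exact: poly_add.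
  apply/funext => x; apply: deriveD; apply: diff_derivable; exact: poly_differentiable.
- rewrite (_ : 'D_v _ = fun x => 'D_v p1 x * q1 x + p1 x * 'D_v q1 x).
    by apply: poly_add; exact: poly_mul.
  by apply/funext => x; apply: derive_mulR; exact: poly_differentiable.
Qed.

Lemma poly_growth d (p : 'rV[R]_d -> R) : poly_fun p ->
  exists C k, 0 <= C /\ forall x, `|p x| <= C * (1 + enorm x) ^+ k.
Proof.
have le1 (x : 'rV[R]_d) : 1 <= 1 + enorm x by rewrite lerDl enorm_ge0.
elim=> [c|i|p1 q1 _ [C1 [k1 [C10 h1]]] _ [C2 [k2 [C20 h2]]]
  |p1 q1 _ [C1 [k1 [C10 h1]]] _ [C2 [k2 [C20 h2]]]].
- by exists `|c|, 0%N; split=> // x; rewrite expr0 mulr1.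
- exists 1, 1%N; split=> // x; rewrite mul1r expr1.
  by rewrite (le_trans (coord_le_enorm x i))// lerDr.
- exists (C1 + C2), (k1 + k2)%N; split=> [|x]; first exact: addr_ge0.
  rewrite (le_trans (ler_normD _ _))// mulrDl lerD//.
    by rewrite (le_trans (h1 x))// ler_wpM2l// ler_weXn2l// leq_addr.
  by rewrite (le_trans (h2 x))// ler_wpM2l// ler_weXn2l// leq_addl.
- exists (C1 * C2), (k1 + k2)%N; split=> [|x]; first exact: mulr_ge0.
  by rewrite normrM exprD mulrACA ler_pM.
Qed.

Definition gauss_decay d (Q : 'rV[R]_d -> R) : Prop :=
  exists C c, 0 < c /\ forall x, expR (- Q x) <= C * expR (- c * dot x x).

(* Stable under differentiation: [- sin] is [cos] with the phase moved by pi / 2. *)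
Inductive gauss_osc d : ('rV[R]_d -> R) -> Prop :=
| osc_term p Q phi : poly_fun p -> poly_fun Q -> gauss_decay Q -> poly_fun phi ->
    gauss_osc (fun x => p x * expR (- Q x) * cos (phi x))
| osc_add f g : gauss_osc f -> gauss_osc g -> gauss_osc (fun x => f x + g x).

Lemma gauss_osc_derive d (f : 'rV[R]_d -> R) v : gauss_osc f ->
  (forall x, differentiable f x) /\ gauss_osc ('D_v f).
Proof.
elim=> [p Q phi pp pQ dQ pphi|f1 g1 gf [df gdf] gg [dg gdg]].
  have dp := poly_differentiable pp; have dQx := poly_differentiable pQ.
  have dphi := poly_differentiable pphi.
  have hE x := derive_comp1 v (differentiableN (dQx x)) (is_derive_expR (- Q x)).
  have hC x := derive_comp1 v (dphi x) (is_derive_cos (phi x)).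
  have hpE x : differentiable (fun y => p y * expR (- Q y)) x.
    by apply: differentiableM => //; case: (hE x).
  split=> [x|]; first by apply: differentiableM => //; case: (hC x).
  rewrite (_ : 'D_v _ = fun x =>
      ('D_v p x + p x * (-1 * 'D_v Q x)) * expR (- Q x) * cos (phi x) +
      (p x * 'D_v phi x) * expR (- Q x) * cos (phi x + pi / 2)); last first.
    apply/funext => x; rewrite derive_mulR//; last by case: (hC x).
    rewrite derive_mulR//; last by case: (hE x).
    have [_ ->] := hE x; have [_ ->] := hC x.
    rewrite (_ : 'D_v (- Q) x = - 'D_v Q x); last first.
      exact/deriveN/diff_derivable.
    by rewrite cosD cos_pihalf sin_pihalf; ring.
  apply: osc_add; apply: osc_term => //.
  - apply: poly_add; first exact: poly_derive.
    apply: poly_mul => //; apply: poly_mul; [exact: poly_cst|exact: poly_derive].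
  - by apply: poly_mul => //; exact: poly_derive.
  - by apply: poly_add => //; exact: poly_cst.
split=> [x|]; first exact: differentiableD.
rewrite (_ : 'D_v _ = fun x => 'D_v f1 x + 'D_v g1 x); first exact: osc_add.
by apply/funext => x; apply: deriveD; exact: diff_derivable.
Qed.

Lemma gauss_osc_bounded d (f : 'rV[R]_d -> R) k : gauss_osc f ->
  exists M : R, forall x, (1 + enorm x) ^+ k * `|f x| <= M.
Proof.
elim=> [p Q phi pp _ [C2 [c [c0 dQ]]] _|f1 g1 _ [M1 h1] _ [M2 h2]]; last first.
  exists (M1 + M2) => x; rewrite (le_trans _ (lerD (h1 x) (h2 x)))// -mulrDr.
  by rewrite ler_wpM2l ?ler_normD// exprn_ge0// addr_ge0// enorm_ge0.
have [C1 [m [C10 h1]]] := poly_growth pp.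
have c20 : 0 < c / 2 by rewrite divr_gt0.
pose E := expR ((k + m)%:R ^+ 2 / (4 * (c / 2))).
exists (C1 * (E * (expR c * `|C2|))) => x.
have r0 : 0 <= 1 + enorm x by rewrite addr_ge0// enorm_ge0.
rewrite !normrM (ger0_norm (expR_ge0 _)).
have cos1 : `|cos (phi x)| <= 1 by rewrite ler_norml cos_geN1 cos_le1.
apply: (@le_trans _ _ ((1 + enorm x) ^+ k * (C1 * (1 + enorm x) ^+ m *
    (`|C2| * expR (- c * dot x x))))).
  rewrite ler_wpM2l ?exprn_ge0//.
  rewrite (le_trans (ler_piMr _ cos1)) ?mulr_ge0 ?expR_ge0//.
  apply: ler_pM; rewrite ?expR_ge0//; rewrite (le_trans (dQ x))//.
  by rewrite ler_wpM2r ?expR_ge0// ler_norm.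
rewrite [leLHS](_ : _ = C1 * (((1 + enorm x) ^+ (k + m) * expR (- c * dot x x)) * `|C2|)).
  rewrite ler_wpM2l// mulrA ler_wpM2r//.
  rewrite -powR_mulrn//.
  rewrite (le_trans (ler_wpM2r (expR_ge0 _) (powR_le_expR (ler0n _ _) c20 r0)))//.
  rewrite -mulrA ler_wpM2l ?expR_ge0// -expRD ler_expR -enormK.
  by have := sqr_ge0 (1 - enorm x); nra.
by rewrite exprD; ring.
Qed.

Lemma gauss_osc_schwartz d (f : 'rV[R]_d -> R) : gauss_osc f -> schwartzR f.
Proof.
move=> gf l; have gl : gauss_osc (partials l f).
  by elim: l => //= i l IH; case: (gauss_osc_derive (delta_mx 0 i) IH).
split; first by case: (gauss_osc_derive 0 gl).
by move=> k; exact: gauss_osc_bounded.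
Qed.

Lemma gauss_osc_sum d I (r : seq I) (f : I -> 'rV[R]_d -> R) :
  (forall i, gauss_osc (f i)) -> gauss_osc (fun x => \sum_(i <- r) f i x).
Proof.
move=> gf; elim: r => [|i r IH]; last first.
  by under eq_fun do rewrite big_cons; exact: osc_add.
under eq_fun do rewrite big_nil.
rewrite (_ : (fun=> 0) = fun x : 'rV[R]_d => 0 * expR (- dot x x) * cos 0); last first.
  by apply/funext => x; rewrite !mul0r.
apply: (@osc_term _ (fun=> 0) (fun x => dot x x) (fun=> 0)); try exact: poly_cst.
  rewrite /dot; elim: (index_enum _) => [|j s IHs].
    by under eq_fun do rewrite big_nil; exact: poly_cst.
  under eq_fun do rewrite big_cons; apply: poly_add => //.
  by apply: poly_mul; exact: poly_coord.
by exists 1, 1; split=> // x; rewrite mul1r mulN1r.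
Qed.

Definition poly_vec d n (F : 'rV[R]_d -> 'rV[R]_n) : Prop :=
  forall i, poly_fun (fun x => F x 0 i).

Lemma poly_dot d n (F G : 'rV[R]_d -> 'rV[R]_n) : poly_vec F -> poly_vec G ->
  poly_fun (fun x => dot (F x) (G x)).
Proof.
move=> pF pG; rewrite /dot; elim: (index_enum _) => [|j s IHs].
  by under eq_fun do rewrite big_nil; exact: poly_cst.
by under eq_fun do rewrite big_cons; apply: poly_add => //; apply: poly_mul.
Qed.

(** The real part of a packet is a constant times exp (- Q) cos phi with Q quadratic and phi of
    degree at most 2; the imaginary part has the phase phi - pi / 2. *)
Lemma schwartz_packets n N (A : R) (tau : 'I_N -> R) (u0 : 'rV[R]_n) : 0 < A ->
  schwartz (on_prod (packets A tau u0)).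
Proof.
move=> A0.
pose X (z : 'rV[R]_(n + n)) := lsubmx z + rsubmx z.
pose Y (z : 'rV[R]_(n + n)) := 2^-1 *: (lsubmx z - rsubmx z).
have pX : poly_vec X.
  by move=> i; rewrite /X; under eq_fun do rewrite !mxE; apply: poly_add; exact: poly_coord.
have pY : poly_vec Y.
  move=> i; rewrite /Y; under eq_fun do rewrite !mxE -mulN1r.
  apply: poly_mul; first exact: poly_cst.
  apply: poly_add; first exact: poly_coord.
  by apply: poly_mul; [exact: poly_cst|exact: poly_coord].
have pu : poly_vec (fun _ : 'rV[R]_(n + n) => u0) by move=> i; exact: poly_cst.
pose S := (16 * A)^-1.
have S0 : 0 < S by rewrite invr_gt0 mulr_gt0.
pose b j := (1 + 4 * S * tau j ^+ 2)^-1.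
have b0 j : 0 < b j.
  rewrite invr_gt0 (lt_le_trans ltr01)// lerDl mulr_ge0 ?sqr_ge0//.
  by rewrite mulr_ge0// ltW.
pose phi j z := - (4 * b j * S * tau j) * dot (X z) (Y z) + 2^-1 * dot u0 (X z).
pose Q j z := b j * S * dot (X z) (X z) + b j * dot (Y z) (Y z).
have pphi j : poly_fun (phi j).
  by apply: poly_add; (apply: poly_mul; [exact: poly_cst|exact: poly_dot]).
have pQ j : poly_fun (Q j).
  by apply: poly_add; (apply: poly_mul; [exact: poly_cst|exact: poly_dot]).
have dQ j : gauss_decay (Q j).
  have [_ [C [c [c0 h]]]] := gauss_bounded_quad (0 : 'rV[R]_n) (mulr_gt0 (b0 j) S0) (b0 j).
  exists C, c; split=> // x; have := h x; rewrite subr0; apply: le_trans; exact: ler_norm.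
have E z : on_prod (packets A tau u0) z = \sum_(j < N)
    (packet_cst n A (tau j))%:C%C * (cexpi (phi j z) * (expR (- Q j z))%:C%C) by [].
split.
  rewrite (_ : (fun x => _) = fun z => \sum_(j < N)
     packet_cst n A (tau j) * expR (- Q j z) * cos (phi j z)); last first.
    by apply/funext => z; rewrite E raddf_sum; apply: eq_bigr => j _ /=; ring.
  apply: gauss_osc_schwartz; apply: gauss_osc_sum => j.
  by apply: (@osc_term _ (fun=> _)) => //; exact: poly_cst.
rewrite (_ : (fun x => _) = fun z => \sum_(j < N)
   packet_cst n A (tau j) * expR (- Q j z) * cos (phi j z + - (pi / 2))); last first.
  apply/funext => z; rewrite E raddf_sum; apply: eq_bigr => j _ /=.
  by rewrite (cosD (phi j z)) cosN sinN cos_pihalf sin_pihalf; ring.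
apply: gauss_osc_schwartz; apply: gauss_osc_sum => j.
apply: (@osc_term _ (fun=> _) _ (fun z => phi j z + - (pi / 2))) => //; first exact: poly_cst.
by apply: poly_add => //; exact: poly_cst.
Qed.

End schwartz_class.

(** * Lower bounds for mixed norms *)

Section Lnorm_lower_bound.
Context d (T : measurableType d) {R : realType} (mu : {measure set T -> \bar R}).
Local Open Scope ereal_scope.

(* Needed because the functions tested below are not known to be measurable. *)
Lemma ge0_le_integral_nonmeas (f g : T -> \bar R) :
  (forall x, 0 <= f x) -> (forall x, f x <= g x) ->
  \int[mu]_x f x <= \int[mu]_x g x.
Proof.
move=> f0 fg; have g0 x : 0 <= g x := le_trans (f0 x) (fg x).
rewrite !ge0_integralTE//; apply: ereal_sup_le => _ /= [h hf <-].
by exists h => // x; exact: le_trans (hf x) (fg x).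
Qed.

(** The L^p norm of the indicator of a set of measure m > 0, with value 1 at p = +oo. *)
Definition Lscale (p : \bar R) (m : R) : R := if p is r%:E then m `^ r^-1 else 1%R.

Lemma Lscale_gt0 p (m : R) : (0 < m)%R -> (0 < Lscale p m)%R.
Proof. by case: p => //= r m0; exact: powR_gt0. Qed.

Lemma Lnorm_ge (p : \bar R) (f : T -> \bar R) (E : set T) (e m : R) :
  1 <= p -> measurable E -> (0 <= e)%R -> (0 < m)%R -> m%:E <= mu E ->
  (forall x, E x -> e%:E <= `|f x|) ->
  (e * Lscale p m)%:E <= Lnorm mu p f.
Proof.
move=> p1 mE e0 m0 mEm fE; rewrite unlock; case: p p1 => [r|_|//].
  rewrite lee_fin => r1; have r0 : (0 < r)%R by rewrite (lt_le_trans ltr01).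
  have ri : (0 <= r^-1)%R by rewrite invr_ge0 ltW.
  have I0 : 0 <= \int[mu]_x `|f x| `^ r.
    by apply: integral_ge0 => x _; exact: poweR_ge0.
  rewrite /= (_ : (e * m `^ r^-1)%:E = ((e `^ r * m)%:E) `^ r^-1); last first.
    rewrite poweR_EFin powRM ?powR_ge0 ?ltW// -powRrM mulfV ?gt_eqF// powRr1//.
  apply: gt0_ler_poweR => //.
  - by rewrite in_itv/= leey lee_fin mulr_ge0 ?powR_ge0 ?(ltW m0).
  - by rewrite in_itv/= leey I0.
  apply: (@le_trans _ _ (\int[mu]_x ((e `^ r)%:E * (\1_E x)%:E))); last first.
    apply: ge0_le_integral_nonmeas => x.
      by rewrite mule_ge0 ?lee_fin ?powR_ge0.
    have [xE|xE] := boolP (x \in E); last first.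
      by rewrite indicE (negbTE xE) mule0 poweR_ge0.
    rewrite indicE xE mule1 -poweR_EFin; apply: gt0_ler_poweR => //.
    - exact: ltW.
    - by rewrite in_itv/= leey lee_fin e0.
    - by rewrite in_itv/= leey abse_ge0.
    - by apply: fE; exact/set_mem.
  rewrite ge0_integralZl_EFin ?powR_ge0//.
    by rewrite integral_indic// setIT EFinM lee_wpmul2l ?lee_fin ?powR_ge0.
  exact/measurable_EFinP/measurable_indic.
(* Case p = +oo. The norm is the essential supremum once [mu setT] is positive; if it were below e,
   the set E would lie in a null set. *)
have mE0 : 0 < mu E by rewrite (lt_le_trans _ mEm)// lte_fin.
have muT : 0 < mu setT by rewrite (lt_le_trans mE0)// le_measure ?inE.
rewrite muT /= mulr1 leNgt; apply/negP => lt.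
have [Z [mZ Z0 NZ]] := ess_sup_inf.ess_sup_ge mu (abse \o f).
suff : mu E <= mu Z by rewrite Z0 leNgt mE0.
apply: le_measure; rewrite ?inE// => x Ex; apply: NZ => /= fx.
by have := le_lt_trans fx lt; rewrite ltNge fE.
Qed.

End Lnorm_lower_bound.

Section mixed_lower_bound.
Context {R : realType}.

Lemma mixed_norm_ge n (p q : \bar R) (F : R -> 'rV[R]_n -> R[i])
    (E : set (measurableTypeR R))
    (B : set 'rV[R]_n) (e m1 m2 : R) :
  (1%:E <= p)%E -> (1%:E <= q)%E -> measurable E -> measurable B ->
  0 <= e -> 0 < m1 -> 0 < m2 ->
  (m1%:E <= lebesgue_measure E)%E -> (m2%:E <= lebesgue_rV n B)%E ->
  (forall t x, E t -> B x -> e <= cmod (F t x)) ->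
  ((e * Lscale q m2 * Lscale p m1)%:E <= mixed_norm p q F)%E.
Proof.
move=> p1 q1 mE mB e0 m10 m20 hE hB FE.
apply: (@Lnorm_ge _ (measurableTypeR R) R lebesgue_measure p _ E) => // [|t Et].
  by rewrite mulr_ge0// ltW// Lscale_gt0.
rewrite gee0_abs ?Lnorm_ge0//; apply: (Lnorm_ge q1 mB e0 m20 hB) => x Bx.
by rewrite abse_EFin lee_fin (le_trans (FE t x Et Bx))// ler_norm.
Qed.

Definition box n (a l : R) : set 'rV[R]_n := [set x | forall i, `[a, (a + l)]%classic (x 0 i)].

Lemma measurable_box n (a l : R) : measurable (@box n a l).
Proof.
rewrite [X in measurable X](_ : _ = \bigcap_(i in [set: 'I_n])
    ((fun x : 'rV[R]_n => x 0 i : measurableTypeR R) @^-1` `[a, (a + l)]%classic)).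
  apply: fin_bigcap_measurable => // i _.
  by rewrite -[X in measurable X]setTI; exact: measurable_coord.
by apply/seteqP; split=> x /= Ax i; [move=> _; exact: Ax | exact: (Ax i I)].
Qed.

Lemma lebesgue_box n (a l : R) : 0 <= l -> lebesgue_rV n (@box n a l) = (l ^+ n)%:E.
Proof.
move=> l0; rewrite /box (lebesgue_rV_box (A := fun=> `[a, (a + l)]%classic))//.
rewrite (eq_bigr (fun=> l%:E)); last first.
  move=> i _; rewrite lebesgue_measure_itv/= lte_fin ltrDl.
  case: ltrP => [_|l0']; first by rewrite -EFinB addrC addKr.
  by congr EFin; apply/eqP; rewrite eq_le l0 l0'.
by elim: n => [|k IH]; rewrite ?big_ord0// big_ord_recl IH -EFinM exprS.
Qed.

Lemma dot_box_le n (a l : R) (x : 'rV[R]_n) : 0 <= a -> 0 <= l -> @box n a l x ->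
  dot x x <= n%:R * (a + l) ^+ 2.
Proof.
move=> a0 l0 Bx; rewrite /dot mulrC mulr_natr -[X in _ *+ X]card_ord -sumr_const.
apply: ler_sum => i _; have /= := Bx i; rewrite in_itv/= => /andP[h1 h2].
by rewrite expr2 ler_pM// (le_trans a0).
Qed.

Lemma Rintegral_ge_box n (f : 'rV[R]_n -> R) (a l e : R) : gauss_bounded f -> 0 <= l ->
  (forall x, 0 <= f x) -> (forall x, @box n a l x -> e <= f x) ->
  e * l ^+ n <= \int[lebesgue_rV n]_x f x.
Proof.
move=> gf l0 f0 fe; have mB := @measurable_box n a l.
have intf := gauss_bounded_integrable gf.
have Bfin : (lebesgue_rV n (@box n a l) < +oo)%E by rewrite lebesgue_box// ltry.
have -> : e * l ^+ n = \int[lebesgue_rV n]_(x in @box n a l) e.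
  rewrite Rintegral_cst//; congr (_ * _).
  by have /(congr1 fine) := @lebesgue_box n a l l0.
rewrite Rintegral_mkcond; apply: le_Rintegral => //.
  rewrite -restrict_EFin; apply/integrable_restrict => //; rewrite setTI.
  by apply: measurable_bounded_integrable => //; exact: bounded_cst.
move=> x _; rewrite /patch; case: ifPn => // /set_mem; exact: fe.
Qed.

Lemma abs_sin_le (y : R) : `|sin y| <= `|y|.
Proof.
wlog y0 : y / 0 < y => [hw|].
  have [y0|y0|->] := ltgtP y 0; [|exact: hw|by rewrite sin0].
  by rewrite -normrN -sinN -[leRHS]normrN hw// oppr_gt0.
have hd x : x \in `]0, y[ -> is_derive x 1 sin (cos x) by move=> _; exact: is_derive_sin.
have [|c _ E] := MVT y0 hd.
  by apply: continuous_subspaceT => x; exact: continuous_sin.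
move: E; rewrite sin0 !subr0 => ->; rewrite normrM ler_piMl//.
by rewrite ler_norml cos_geN1 cos_le1.
Qed.

Lemma cos_ge_quad (y : R) : 1 - y ^+ 2 / 2 <= cos y.
Proof.
have -> : cos y = 1 - 2 * sin (y / 2) ^+ 2.
  have -> : y = y / 2 + y / 2 by field.
  rewrite cosD -!expr2 cos2sin2.
  by rewrite (_ : (y / 2 + y / 2) / 2 = y / 2); [ring|field].
have : sin (y / 2) ^+ 2 <= (y / 2) ^+ 2.
  rewrite -(real_normK (num_real (sin _))) -(real_normK (num_real (y / 2))) ler_sqr ?nnegrE//.
  exact: abs_sin_le.
by rewrite expr_div_n; lra.
Qed.

(** Cauchy-Schwarz inside cos y >= 1 - y^2 / 2. At least half of the mass survives as long as |x|^2
    times the second moment of m about u0 is at most the mass. *)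
Lemma Rintegral_cos_ge n (x u0 : 'rV[R]_n) (m : 'rV[R]_n -> R) :
  gauss_bounded m -> (forall u, 0 <= m u) ->
  gauss_bounded (fun u => dot (u - u0) (u - u0) * m u) ->
  \int[lebesgue_rV n]_u m u -
    2^-1 * dot x x * \int[lebesgue_rV n]_u (dot (u - u0) (u - u0) * m u) <=
  \int[lebesgue_rV n]_u (cos (dot x (u - u0)) * m u).
Proof.
move=> gm m0 gm2; have im := gauss_bounded_integrable gm.
have im2 := gauss_bounded_integrable (gauss_boundedZ (2^-1 * dot x x) gm2).
rewrite -RintegralZl//; last exact: gauss_bounded_integrable.
rewrite -RintegralB//; apply: le_Rintegral => //.
- exact: (integrableB _ im im2).
- apply/gauss_bounded_integrable/(gauss_boundedM (M := 1)) => //.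
    apply: measurable_cos_comp; apply: measurable_dot => //; exact: measurable_vecD.
  by move=> u; rewrite ler_norml cos_geN1 cos_le1.
- move=> u _; rewrite (_ : m u - _ = (1 - 2^-1 * (dot x x * dot (u - u0) (u - u0))) * m u).
    rewrite ler_wpM2r// (le_trans _ (cos_ge_quad _))//.
    by have := dot_CS x (u - u0); lra.
  by ring.
Qed.

Lemma powR_nat_unbounded (beta M : R) : 0 < beta ->
  (forall N, (0 < N)%N -> N%:R `^ beta <= M) -> False.
Proof.
move=> b0 h; have M0 : 0 <= M by rewrite (le_trans _ (h 1%N _))// powR_ge0.
pose y := (M + 1) `^ beta^-1; pose N := (Num.truncn y).+1.
have := h N isT; rewrite leNgt => /negP; apply.
apply: (@lt_le_trans _ _ (M + 1)); first by rewrite ltrDl.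
have M1 : 0 <= M + 1 by rewrite addr_ge0.
have -> : M + 1 = y `^ beta by rewrite -powRrM mulVf ?gt_eqF// powRr1.
apply: (ge0_ler_powR (ltW b0)); rewrite ?nnegrE ?powR_ge0//.
exact/ltW/truncnS_gt.
Qed.

End mixed_lower_bound.

(** * Lower bounds for the two families of test functions *)

Section moments.
Context {R : realType} (n : nat) (alpha : R).
Hypothesis a0 : 0 <= alpha.
Hypothesis n0 : (0 < n)%N.

Let gw (c : R) (xi : 'rV[R]_n) := enorm xi `^ alpha * expR (- c * dot xi xi).
Let M0 c := \int[lebesgue_rV n]_xi gw c xi.
Let M2 c := \int[lebesgue_rV n]_xi (dot xi xi * gw c xi).

Let gw_ge0 c xi : 0 <= gw c xi.
Proof. by rewrite mulr_ge0 ?powR_ge0 ?expR_ge0. Qed.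

Let gwb c : 0 < c -> gauss_bounded (gw c).
Proof. by move=> c0; apply: gauss_bounded_powR => //; exact: gauss_bounded_gauss. Qed.

Let gwb2 c : 0 < c -> gauss_bounded (fun xi => dot xi xi * gw c xi).
Proof.
move=> c0; have := gauss_bounded_dot 0 (gwb c0).
by under eq_fun do rewrite subr0.
Qed.

(** Boxes based at 1 stay away from the origin, where |xi|^alpha may vanish; a coordinate to test
    this on exists because n > 0. *)
Lemma enorm_powR_box_ge1 l xi : @box R n 1 l xi -> 1 <= enorm xi `^ alpha.
Proof.
move=> Bx; have := Bx (Ordinal n0); rewrite /= in_itv/= => /andP[h1 _].
have h : 1 <= enorm xi.
  by rewrite (le_trans _ (coord_le_enorm xi (Ordinal n0)))// (le_trans h1)// ler_norm.
have -> : 1 = 1 `^ alpha :> R by rewrite powR1.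
apply: (ge0_ler_powR a0); rewrite ?nnegrE//.
exact: enorm_ge0.
Qed.

Let M0_gt0 c : 0 < c -> 0 < M0 c.
Proof.
move=> c0; apply: (@lt_le_trans _ _ (expR (- c * (n%:R * (1 + 1) ^+ 2)) * 1 ^+ n)).
  by rewrite expr1n mulr1 expR_gt0.
apply: (Rintegral_ge_box (a := 1)) => //; first exact: gwb.
move=> xi Bx; rewrite -[leLHS]mul1r ler_pM ?expR_ge0 ?(enorm_powR_box_ge1 Bx)//.
by rewrite ler_expR !mulNr lerN2 ler_pM2l// dot_box_le.
Qed.

Let M0_le c c' : 0 < c -> c <= c' -> M0 c' <= M0 c.
Proof.
move=> c0 cc'; apply: le_Rintegral => //.
- exact/gauss_bounded_integrable/gwb/(lt_le_trans c0).
- exact/gauss_bounded_integrable/gwb.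
- move=> xi _; rewrite ler_wpM2l ?powR_ge0// ler_expR !mulNr lerN2.
  by rewrite ler_wpM2r ?dot_ge0.
Qed.

(** The mean of |xi|^2 for the weight of rate 1. A larger rate can only lower this mean, so the
    single bound [r0] serves every packet, however far its [tau] is from t. *)
Let r0 := M2 1 / M0 1.

(* Chebyshev: [r0 - y] and [exp (- (c - 1) y) - exp (- (c - 1) r0)] have the
   same sign. *)
Let M2_le c : 1 <= c -> M2 c <= r0 * M0 c.
Proof.
move=> c1; have c0 : 0 < c by rewrite (lt_le_trans ltr01).
have i0 c' : 0 < c' -> integrable_rV (fun xi => r0 * gw c' xi).
  by move=> c'0; exact/gauss_bounded_integrable/gauss_boundedZ/gwb.
have i2 c' : 0 < c' -> integrable_rV (fun xi => dot xi xi * gw c' xi).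
  by move=> c'0; exact/gauss_bounded_integrable/gwb2.
have E c' : 0 < c' -> r0 * M0 c' - M2 c' =
    \int[lebesgue_rV n]_xi ((r0 - dot xi xi) * gw c' xi).
  move=> c'0; rewrite -RintegralZl//; last exact/gauss_bounded_integrable/gwb.
  rewrite -RintegralB//; [|exact: i0|exact: i2].
  by apply: eq_Rintegral => xi _; rewrite mulrBl.
have gb c' : 0 < c' -> gauss_bounded (fun xi => (r0 - dot xi xi) * gw c' xi).
  move=> c'0; have := gauss_boundedD (gauss_boundedZ r0 (gwb c'0)) (gauss_boundedN (gwb2 c'0)).
  by under eq_fun do rewrite -mulrBl.
rewrite -subr_ge0 E//.
have <- : expR (- (c - 1) * r0) * (r0 * M0 1 - M2 1) = 0.
  by rewrite /r0 mulfVK ?subrr ?mulr0// gt_eqF// M0_gt0.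
rewrite E// -RintegralZl//; last exact/gauss_bounded_integrable/gb.
apply: le_Rintegral => //.
- exact/gauss_bounded_integrable/gauss_boundedZ/gb.
- exact/gauss_bounded_integrable/gb.
- move=> xi _; rewrite /gw; set y := dot xi xi.
  have -> : - c * y = - (c - 1) * y + - 1 * y by ring.
  rewrite expRD -subr_ge0.
  rewrite (_ : _ - _ = enorm xi `^ alpha * expR (- 1 * y) *
    ((r0 - y) * (expR (- (c - 1) * y) - expR (- (c - 1) * r0)))); last by ring.
  have cm : 0 <= c - 1 by rewrite subr_ge0.
  apply: mulr_ge0; first by rewrite mulr_ge0 ?powR_ge0 ?expR_ge0.
  have [yr|yr] := lerP y r0.
    apply: mulr_ge0; rewrite subr_ge0// ler_expR !mulNr lerN2.
    exact: ler_wpM2l.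
  apply: mulr_le0; rewrite subr_le0 ?(ltW yr)// ler_expR !mulNr lerN2.
  exact/ler_wpM2l/ltW.
Qed.

(** For |x|^2 <= delta each packet retains half of its mass, hence contributes a positive amount,
    and the distant ones may simply be dropped. The j-th one has rate 1 + (tau j - t)^2 / 4 <= 2,
    whence e = [M0 2 / 2]; delta is such that |x|^2 [r0] <= 1. *)
Lemma time_translates_lower_bound : exists delta e : R, [/\ 0 < delta, 0 < e &
  forall N (tau : 'I_N -> R) (t : R) (x : 'rV[R]_n) (j : 'I_N),
    (tau j - t) ^+ 2 <= 4 -> dot x x <= delta ->
    e <= \int[lebesgue_rV n]_xi (cos (dot x (xi - 0)) *
      (enorm xi `^ alpha * density_hat 1 tau 0 t xi))].
Proof.
have m1 : 0 < M0 1 by exact: M0_gt0.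
have m2 : 0 < M0 2 by exact: M0_gt0.
have M21 : 0 <= M2 1.
  by apply: Rintegral_ge0 => xi _; rewrite mulr_ge0 ?dot_ge0.
have r00 : 0 <= r0 := divr_ge0 M21 (ltW m1).
exists (1 + r0)^-1, (M0 2 / 2); split; first by rewrite invr_gt0 ltr_wpDr.
  by rewrite divr_gt0.
move=> N tau t x j tj xd.
pose c k := 1 + (tau k - t) ^+ 2 / 4.
have c1 k : 1 <= c k by rewrite lerDl divr_ge0// sqr_ge0.
have c0 k : 0 < c k by rewrite (lt_le_trans ltr01).
have gc k : gauss_bounded (fun xi => cos (dot x (xi - 0)) * gw (c k) xi).
  apply: (gauss_boundedM (M := 1)) (gwb (c0 k)).
    by apply: measurable_cos_comp; apply: measurable_dot => //; exact: measurable_vecD.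
  by move=> xi; rewrite ler_norml cos_geN1 cos_le1.
have -> : \int[lebesgue_rV n]_xi (cos (dot x (xi - 0)) *
      (enorm xi `^ alpha * density_hat 1 tau 0 t xi)) =
    \sum_(k < N) \int[lebesgue_rV n]_xi (cos (dot x (xi - 0)) * gw (c k) xi).
  rewrite -Rintegral_rV_sum//; apply: eq_Rintegral => xi _.
  rewrite /density_hat [enorm _ `^ _ * _]mulr_sumr mulr_sumr.
  apply: eq_bigr => k _; congr (_ * (_ * expR _)).
  by rewrite /c !subr0 -scalerBl !dotE; field.
have lower k : M0 (c k) / 2 <= \int[lebesgue_rV n]_xi (cos (dot x (xi - 0)) * gw (c k) xi).
  apply: le_trans (Rintegral_cos_ge _ (gwb (c0 k)) _ _) => //; last first.
    exact: (gauss_bounded_dot 0 (gwb (c0 k))).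
  rewrite (_ : \int[_]_u (dot _ _ * _) = M2 (c k)); last first.
    by apply: eq_Rintegral => u _; rewrite subr0.
  have h1 := M2_le (c1 k); have h0 := M0_gt0 (c0 k); rewrite -/(M0 (c k)).
  have xd2 : dot x x * r0 <= 1.
    rewrite (le_trans (ler_wpM2r r00 xd))// mulrC ler_pdivrMr ?mul1r ?lerDr//.
    by rewrite ltr_wpDr.
  suff dM : dot x x * M2 (c k) <= M0 (c k).
    by rewrite -mulrA lerBrDr [leRHS]splitr lerD2l mulrC ler_wpM2r ?invr_ge0.
  rewrite (le_trans (ler_wpM2l (dot_ge0 x) h1))// mulrA.
  by rewrite -[leRHS]mul1r ler_wpM2r// ltW.
have lower0 k : 0 <= \int[lebesgue_rV n]_xi (cos (dot x (xi - 0)) * gw (c k) xi).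
  by apply: le_trans (lower k); apply: divr_ge0 => //; exact/ltW/M0_gt0.
rewrite (bigD1 j)//= (le_trans _ (lerD (lower j) (sumr_ge0 _ (fun k _ => lower0 k))))//.
rewrite addr0; apply: ler_wpM2r; first by rewrite invr_ge0.
apply: M0_le => //; rewrite /c -lerBrDl ler_pdivrMr// (le_trans tj)//.
rewrite le_eqVlt; apply/orP; left; apply/eqP; ring.
Qed.

(** The transform concentrates within distance 1/L of u0: its mass is at least of order L^(-n), its
    second moment about u0 at most of order L^(-n-2). The cosine is therefore harmless up to |x| of
    order L. *)
Lemma wide_packet_lower_bound : exists delta e : R, [/\ 0 < delta, 0 < e &
  forall (L t : R) (x : 'rV[R]_n), 1 <= L -> t ^+ 2 <= 1 -> dot x x <= delta * L ^+ 2 ->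
    e * (L^-1) ^+ n <= \int[lebesgue_rV n]_xi (cos (dot x (xi - const_mx 1)) *
      (enorm xi `^ alpha *
       density_hat (L ^+ 2) (fun _ : 'I_1 => 0) (const_mx 1) t xi))].
Proof.
pose u0 : 'rV[R]_n := const_mx 1.
have u00 : dot u0 u0 = n%:R.
  by rewrite /dot; under eq_bigr do rewrite !mxE mulr1; rewrite sumr_const card_ord.
pose C1 : R := 4 * (expR (alpha ^+ 2 / (4 * 8^-1)) * expR (n%:R / 4)) * Num.sqrt (2 * pi) ^+ n.
have C10 : 0 < C1.
  rewrite mulr_gt0 ?mulr_gt0 ?expR_gt0// exprn_gt0// sqrtr_gt0 mulr_gt0// pi_gt0.
  by [].
(* On the box [1, 1 + 1/L]^n each of L^2 |xi - u0|^2 and t^2 |xi|^2 / 4 is at most n. *)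
pose e0 : R := expR (- (2 * n%:R)).
have e00 : 0 < e0 by exact: expR_gt0.
exists (e0 / C1), (e0 / 2); split; [exact: divr_gt0|exact: divr_gt0|].
move=> L t x L1 t1 xd; have L0 : 0 < L by rewrite (lt_le_trans ltr01).
have A0 : 0 < L ^+ 2 by rewrite exprn_gt0.
have A1 : 1 <= L ^+ 2 by rewrite -(expr1n _ 2) ler_sqr ?nnegrE// ltW.
rewrite -/u0; pose h := density_hat (L ^+ 2) (fun _ : 'I_1 => 0) u0 t.
have hE xi : h xi = expR (- (L ^+ 2 * dot (xi - u0) (xi - u0) + t ^+ 2 * dot xi xi / 4)).
  rewrite /h /density_hat big_ord1 scale0r sub0r; congr expR.
  by rewrite (dotNl (t *: xi)) dotNr dotZl dotZr; ring.
pose m xi := enorm xi `^ alpha * h xi.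
have gm : gauss_bounded m.
  by apply: gauss_bounded_powR => //; exact: gauss_bounded_density_hat.
have m0 xi : 0 <= m xi by rewrite mulr_ge0 ?powR_ge0// density_hat_ge0.
have gm2 := gauss_bounded_dot u0 gm.
apply: le_trans (Rintegral_cos_ge x gm m0 gm2).
have Li0 : 0 <= L^-1 by rewrite invr_ge0 ltW.
have Li1 : L^-1 <= 1 by rewrite invf_le1.
have I0 : e0 * (L^-1) ^+ n <= \int[lebesgue_rV n]_xi m xi.
  apply: (Rintegral_ge_box (a := 1)) => // xi Bx.
  rewrite -[leLHS]mul1r ler_pM ?expR_ge0 ?(enorm_powR_box_ge1 Bx)//.
  rewrite hE ler_expR lerN2.
  have d1 : dot xi xi <= n%:R * 4.
    rewrite (le_trans (dot_box_le _ _ Bx))// ler_wpM2l//.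
    by have := Li1; have := Li0; nra.
  have d2 : dot (xi - u0) (xi - u0) <= n%:R * (0 + L^-1) ^+ 2.
    apply: (dot_box_le (a := 0)) => // i; have := Bx i.
    by rewrite /= !in_itv/= !mxE => /andP[? ?]; apply/andP; split; lra.
  have d3 : L ^+ 2 * dot (xi - u0) (xi - u0) <= n%:R.
    rewrite (le_trans (ler_wpM2l (ltW A0) d2))// add0r mulrCA -exprMn.
    by rewrite mulfV ?gt_eqF// expr1n mulr1.
  have d4 := dot_ge0 xi.
  have : t ^+ 2 * dot xi xi <= 1 * (n%:R * 4) by rewrite ler_pM ?sqr_ge0.
  by move: d3; lra.
have I2 : \int[lebesgue_rV n]_xi (dot (xi - u0) (xi - u0) * m xi) <=
    C1 * (L^-1) ^+ 2 * (L^-1) ^+ n.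
  pose K : R := 4 * (L^-1) ^+ 2 * (expR (alpha ^+ 2 / (4 * 8^-1)) * expR (n%:R / 4)).
  have gG : gauss_bounded (fun xi : 'rV[R]_n =>
      K * expR (- (L ^+ 2 / 2) * dot (- u0 + xi) (- u0 + xi))).
    apply: gauss_boundedZ; apply: (gauss_bounded_shift (- u0) (gauss_bounded_gauss n _)).
    exact: divr_gt0.
  apply: (@le_trans _ _ (\int[lebesgue_rV n]_xi
      (K * expR (- (L ^+ 2 / 2) * dot (- u0 + xi) (- u0 + xi))))).
    apply: le_Rintegral => //; [exact: gauss_bounded_integrable|exact: gauss_bounded_integrable|].
    move=> xi _; rewrite [- u0 + _]addrC /m hE; set y := dot (xi - u0) (xi - u0).
    have y0 : 0 <= y := dot_ge0 _.
    have p8 : 0 < 8^-1 :> R by [].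
    have b1 := powR_le_expR a0 p8 (enorm_ge0 xi); rewrite enormK in b1.
    have b2 : expR (8^-1 * dot xi xi) <= expR (n%:R / 4) * expR (y / 4).
      rewrite -expRD ler_expR.
      have := dot_sub_le (xi - u0) (- u0).
      by rewrite opprK subrK (dotNl u0) dotNr opprK u00 -/y; lra.
    (* Budget for the decay exp (- L^2 y): one quarter pays for the factor y and produces L^(-2), a
       second one covers the exp (y / 4) left by |xi|^alpha since L >= 1, and half remains to be
       integrated. *)
    have b3 : y <= 4 * (L^-1) ^+ 2 * expR (L ^+ 2 * y / 4).
      rewrite -ler_pdivrMl ?mulr_gt0 ?exprn_gt0 ?invr_gt0//.
      rewrite [leLHS](_ : _ = L ^+ 2 * y / 4); last by field; exact: lt0r_neq0.
      by rewrite (le_trans _ (expR_ge1Dx _))// lerDr.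
    have b4 : expR (- (L ^+ 2 * y + t ^+ 2 * dot xi xi / 4)) <= expR (- (L ^+ 2 * y)).
      by rewrite ler_expR lerN2 lerDl divr_ge0// mulr_ge0 ?sqr_ge0 ?dot_ge0.
    have b12 : enorm xi `^ alpha <=
        expR (alpha ^+ 2 / (4 * 8^-1)) * (expR (n%:R / 4) * expR (y / 4)).
      by rewrite (le_trans b1)// ler_wpM2l ?expR_ge0.
    have b124 := ler_pM (powR_ge0 _ _) (expR_ge0 _) b12 b4.
    have := ler_pM y0 (mulr_ge0 (powR_ge0 _ _) (expR_ge0 _)) b3 b124.
    move=> /le_trans; apply.
    rewrite [leLHS](_ : _ = K *
        (expR (L ^+ 2 * y / 4) * expR (y / 4) * expR (- (L ^+ 2 * y)))).
      apply: ler_wpM2l; first by rewrite !mulr_ge0 ?exprn_ge0 ?expR_ge0.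
      rewrite -!expRD ler_expR; move: (ler_wpM2r y0 A1).
      by lra.
    by rewrite /K; ring.
  rewrite RintegralZl//; last first.
    apply: gauss_bounded_integrable.
    apply: (gauss_bounded_shift (- u0) (gauss_bounded_gauss n _)); exact: divr_gt0.
  rewrite (Rintegral_rV_shift (- u0) (measurable_gauss_rV (L ^+ 2 / 2))).
  rewrite {1}/Rintegral integral_gauss_rV ?divr_gt0//=.
  rewrite (_ : pi / (L ^+ 2 / 2) = 2 * pi * (L^-1) ^+ 2); last by field; exact: lt0r_neq0.
  rewrite sqrtrM ?mulr_ge0 ?pi_ge0// sqrtr_sqr ger0_norm// exprMn /K /C1.
  by rewrite le_eqVlt; apply/orP; left; apply/eqP; ring.
have LL : L ^+ 2 * (L^-1) ^+ 2 = 1 by rewrite -exprMn mulfV ?gt_eqF// expr1n.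
have xC : dot x x * (C1 * (L^-1) ^+ 2) <= e0.
  rewrite (le_trans (ler_wpM2r _ xd)) ?mulr_ge0 ?exprn_ge0 ?(ltW C10)//.
  rewrite [leLHS](_ : _ = e0 * (L ^+ 2 * (L^-1) ^+ 2)); last by field; rewrite !lt0r_neq0.
  by rewrite LL mulr1.
have Ln0 : 0 <= (L^-1) ^+ n by rewrite exprn_ge0.
have h3 := ler_wpM2l (dot_ge0 x) I2; have h4 := ler_wpM2r Ln0 xC.
move: I0 h3 h4; set I := \int[_]_u m u; set J := \int[_]_u _; set y := (L^-1) ^+ n.
move: (C1 * (L^-1) ^+ 2) => k; move: (dot x x) => dx.
by move=> I0 h3 h4; nra.
Qed.

End moments.

(** * Testing the estimate on the two families *)

Section testing.
Context {R : realType}.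

Lemma powR_cancel (a b u v y : R) : 0 < a -> 0 < y ->
  a * y `^ u <= b * y `^ v -> y `^ (u - v) <= b / a.
Proof.
move=> a0 y0 h; rewrite ler_pdivlMr// mulrC.
rewrite -(ler_pM2r (powR_gt0 v y0)) -mulrA -powRD ?subrK//.
by rewrite (gt_eqF y0) implybT.
Qed.

Lemma sobolev_cst_ge0 n s (u0 : 'rV[R]_n) : 0 <= sobolev_cst s u0.
Proof. by rewrite mulr_ge0 ?expR_ge0. Qed.

Lemma packets_test (n N : nat) (p q : \bar R) (alpha s K A : R)
    (tau : 'I_N -> R) (u0 : 'rV[R]_n) (E : set (measurableTypeR R))
    (B : set 'rV[R]_n) (e m1 m2 : R) :
  (forall Gamma0 : 'rV[R]_n -> 'rV[R]_n -> R[i], schwartz (on_prod Gamma0) ->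
    (mixed_norm p q (fun t => abs_nabla alpha (fun x => propagator t Gamma0 x x))
     <= K%:E * sobolev_norm s (on_prod Gamma0))%E) ->
  (1%:E <= p)%E -> (1%:E <= q)%E -> 0 <= alpha -> 0 <= s -> 1 <= A ->
  measurable E -> measurable B -> 0 <= e -> 0 < m1 -> 0 < m2 ->
  (m1%:E <= lebesgue_measure E)%E -> (m2%:E <= lebesgue_rV n B)%E ->
  (forall t x, E t -> B x -> e <= \int[lebesgue_rV n]_xi
     (cos (dot x (xi - u0)) * (enorm xi `^ alpha * density_hat A tau u0 t xi))) ->
  diag_cst n * fourier_cst n * e * Lscale q m2 * Lscale p m1 <=
  `|K| * Num.sqrt (sobolev_cst s u0 * \sum_j \sum_k
    (Num.sqrt pi ^+ n * Num.sqrt (pi / (A + (tau j - tau k) ^+ 2 / 4)) ^+ n)).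
Proof.
move=> HK p1 q1 a0 s0 A1 mE mB e0 m10 m20 hE hB He.
have A0 : 0 < A by rewrite (lt_le_trans ltr01).
have c0 : 0 <= diag_cst n * fourier_cst n :> R.
  by rewrite mulr_ge0// ltW// ?diag_cst_gt0 ?fourier_cst_gt0.
have ce0 : 0 <= diag_cst n * fourier_cst n * e := mulr_ge0 c0 e0.
rewrite -lee_fin.
apply: (le_trans (mixed_norm_ge p1 q1 mE mB ce0 m10 m20 hE hB
  (F := fun t => abs_nabla alpha (fun x => propagator t (packets A tau u0) x x)) _)).
  move=> t x Et Bx; apply: le_trans (cmod_abs_nabla_ge tau u0 A0 t x a0).
  by apply: ler_wpM2l => //; exact: He.
apply: (le_trans (HK _ (schwartz_packets tau u0 A0))).
(* The sign of [K] is unknown; |K| makes the product monotone in the Sobolev norm. *)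
apply: (@le_trans _ _ (`|K|%:E * sobolev_norm s (on_prod (packets A tau u0)))%E).
  by apply: lee_wpmul2r; [exact: Lnorm_ge0|rewrite lee_fin ler_norm].
by rewrite EFinM; apply: lee_wpmul2l; [rewrite lee_fin|exact: sobolev_packets_le].
Qed.

Lemma time_shift_sqr_ge (N : nat) (j k : 'I_N) : j != k ->
  N%:R ^+ 2 <= ((j * N)%:R - (k * N)%:R) ^+ 2 :> R.
Proof.
move=> jk; rewrite !natrM -mulrBl exprMn ler_peMl ?sqr_ge0//.
wlog lt_jk : j k jk / (j < k)%N.
  move=> H; move: (jk); rewrite -val_eqE/= neq_ltn => /orP[/H|/H kj]; first exact.
  by rewrite -sqrrN opprB kj// eq_sym.
rewrite -sqrrN opprB -natrB ?(ltnW lt_jk)// -natrX ler1n expn_gt0.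
by rewrite subn_gt0 lt_jk.
Qed.

(** For j != k the difference of times is at least N, so the factor (1 + T^2 / 4)^(-n/2) is at most
    2 / N, a single power of the decay being enough. The diagonal adds at most N and the remainder
    at most N^2 (2 / N), which is the constant 3. *)
Lemma time_translates_sum_le n N : (0 < n)%N -> (0 < N)%N ->
  \sum_(j < N) \sum_(k < N) (Num.sqrt pi ^+ n *
    Num.sqrt (pi / (1 + ((j * N)%:R - (k * N)%:R) ^+ 2 / 4)) ^+ n) <=
  (Num.sqrt pi ^+ n * Num.sqrt pi ^+ n * 3) * N%:R :> R.
Proof.
move=> n0 N0; have N0' : 0 < N%:R :> R by rewrite ltr0n.
have P0 : 0 <= Num.sqrt pi ^+ n * Num.sqrt pi ^+ n :> R.
  by rewrite mulr_ge0// exprn_ge0// sqrtr_ge0.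
have term (j k : 'I_N) : Num.sqrt pi ^+ n *
    Num.sqrt (pi / (1 + ((j * N)%:R - (k * N)%:R) ^+ 2 / 4)) ^+ n <=
    Num.sqrt pi ^+ n * Num.sqrt pi ^+ n * ((k == j)%:R + 2 / N%:R) :> R.
  set D := 1 + _; have D1 : 1 <= D by rewrite lerDl divr_ge0// sqr_ge0.
  have D0 : 0 < D by rewrite (lt_le_trans ltr01).
  rewrite sqrtrM ?pi_ge0// exprMn [leLHS]mulrA ler_wpM2l//.
  have S1 : Num.sqrt D^-1 <= 1 by rewrite -sqrtr1 ler_sqrt// invf_le1.
  apply: (@le_trans _ _ (Num.sqrt D^-1)).
    by rewrite -[leRHS]expr1 ler_wiXn2l// sqrtr_ge0.
  case: eqVneq => [_|kj]; first by rewrite (le_trans S1)// lerDl divr_ge0.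
  rewrite add0r -[leRHS]ger0_norm ?divr_ge0// -sqrtr_sqr ler_sqrt ?exprn_gt0 ?divr_gt0//.
  rewrite -[leRHS]invrK lef_pV2 ?posrE ?invr_gt0 ?exprn_gt0 ?divr_gt0//.
  rewrite exprMn exprVn invfM invrK mulrC /D.
  rewrite (le_trans (ler_wpM2r _ (time_shift_sqr_ge (_ : j != k))))//.
  - by rewrite eq_sym.
  - rewrite (_ : 2 ^+ 2 = 4) ?lerDr//; ring.
apply: (@le_trans _ _ (\sum_(j < N) (Num.sqrt pi ^+ n * Num.sqrt pi ^+ n * 3))).
  apply: ler_sum => j _; apply: (le_trans (ler_sum _ (fun k _ => term j k))).
  rewrite -mulr_sumr ler_wpM2l// big_split/= sumr_const card_ord.
  rewrite -[_ / _ *+ _]mulr_natr mulfVK ?gt_eqF//.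
  rewrite (bigD1 j)//= eqxx big1 => [|k /negPf ->//].
  by rewrite addr0 -natrD.
by rewrite sumr_const card_ord [leRHS]mulr_natr.
Qed.

Lemma exists_time_set N : (0 < N)%N -> exists E : set (measurableTypeR R),
  [/\ measurable E, lebesgue_measure E = N%:R%:E &
   forall t, E t -> exists j : 'I_N, ((j * N)%:R - t) ^+ 2 <= 4].
Proof.
move=> N0; pose I (j : 'I_N) : set (measurableTypeR R) := `[(j * N)%:R, (j * N)%:R + 1[%classic.
have mI j : measurable (I j) by exact: measurable_itv.
have tI : trivIset setT I.
  apply/trivIsetP => j k _ _; wlog jk : j k / (j < k)%N.
    move=> H; rewrite -val_eqE/= neq_ltn => /orP[jk|kj].
      by apply: H => //; rewrite -val_eqE/= neq_ltn jk.
    by rewrite setIC; apply: H => //; rewrite -val_eqE/= neq_ltn kj.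
  move=> _; rewrite -subset0 /I => t/=; rewrite !in_itv/= => -[/andP[_ h1] /andP[h2 _]].
  have := le_lt_trans h2 h1; rewrite -(natrD _ _ 1) ltr_nat ltnNge => /negP; apply.
  by rewrite (leq_trans (_ : _ <= j.+1 * N)%N)// ?leq_mul2r ?jk ?orbT// mulSn addnC leq_add2r.
exists (\big[setU/set0]_(j < N) I j); split.
- by apply: bigsetU_measurable => j _.
- rewrite measure_bigsetU_ord// (eq_bigr (fun=> 1%E)) => [|j _].
    by rewrite sumEFin sumr_const card_ord.
  by rewrite [LHS]lebesgue_measure_itv/= lte_fin ltrDl ltr01 -EFinD addrAC subrr add0r.
- move=> t; rewrite -bigcup_seq => -[j _]; rewrite /I/= in_itv/= => /andP[h1 h2].
  by exists j; move: h1 h2; move: (j * N)%:R => c; nra.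
Qed.

Lemma time_exponent_ge2 (n : nat) (p q : \bar R) (alpha s K : R) :
  (1 <= n)%N -> (1%:E <= p)%E -> (1%:E <= q)%E -> 0 <= alpha -> 0 <= s ->
  (forall Gamma0 : 'rV[R]_n -> 'rV[R]_n -> R[i], schwartz (on_prod Gamma0) ->
    (mixed_norm p q (fun t => abs_nabla alpha (fun x => propagator t Gamma0 x x))
     <= K%:E * sobolev_norm s (on_prod Gamma0))%E) ->
  (2%:E <= p)%E.
Proof.
move=> n0 p1 q1 a0 s0 HK; case: p p1 HK => [r|_ _|//]; last exact: leey.
rewrite lee_fin => r1 HK; rewrite lee_fin leNgt; apply/negP => r2.
have r0 : 0 < r by rewrite (lt_le_trans ltr01).
have [delta [e [d0 e0 He]]] := @time_translates_lower_bound R n alpha a0 n0.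
have nR : 0 < n%:R :> R by rewrite ltr0n.
(* Chosen with n l^2 = delta, so that |x|^2 <= delta on the box of side l. *)
pose l := Num.sqrt (delta / n%:R).
have l0 : 0 < l by rewrite sqrtr_gt0 divr_gt0.
pose a := diag_cst n * fourier_cst n * e * Lscale q (l ^+ n).
have aa0 : 0 < a.
  rewrite mulr_gt0 ?Lscale_gt0 ?exprn_gt0// mulr_gt0//.
  by rewrite mulr_gt0 ?diag_cst_gt0 ?fourier_cst_gt0.
pose P : R := Num.sqrt pi ^+ n * Num.sqrt pi ^+ n * 3.
pose b := `|K| * Num.sqrt (sobolev_cst s (0 : 'rV[R]_n) * P).
apply: (@powR_nat_unbounded R (r^-1 - 2^-1) (b / a)).
  by rewrite subr_gt0 ltf_pV2 ?posrE.
move=> N N0; have N0' : 0 < N%:R :> R by rewrite ltr0n.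
apply: powR_cancel => //.
have [E [mE hE HE]] := exists_time_set N0.
pose tau (j : 'I_N) : R := (j * N)%:R.
have xB x : @box R n 0 l x -> dot x x <= delta.
  move=> /(dot_box_le (lexx 0) (ltW l0)) /le_trans; apply.
  by rewrite add0r sqr_sqrtr ?divr_ge0 ?(ltW d0)// mulrC divfK ?gt_eqF.
have H := @packets_test n N r%:E q alpha s K 1 tau 0 E
  (@box R n 0 l) e N%:R (l ^+ n) HK _ q1 a0 s0 (lexx _) mE
  (@measurable_box R n 0 l) (ltW e0) N0' (exprn_gt0 _ l0).
rewrite -/a/= in H; apply: (le_trans (H _ _ _ _)) => //.
- by rewrite hE.
- by rewrite lebesgue_box// ltW.
- move=> t x /HE[j tj] /xB xd; exact: (He N tau t x j).
- rewrite /b powR12_sqrt ?(ltW N0')// -[leRHS]mulrA ler_wpM2l//.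
  rewrite -sqrtrM; last first.
    by rewrite mulr_ge0 ?sobolev_cst_ge0// mulr_ge0// mulr_ge0 ?exprn_ge0 ?sqrtr_ge0.
  rewrite ler_wsqrtr// -[leRHS]mulrA ler_wpM2l ?sobolev_cst_ge0//.
  exact: time_translates_sum_le.
Qed.

Lemma space_exponent_ge2 (n : nat) (p q : \bar R) (alpha s K : R) :
  (1 <= n)%N -> (1%:E <= p)%E -> (1%:E <= q)%E -> 0 <= alpha -> 0 <= s ->
  (forall Gamma0 : 'rV[R]_n -> 'rV[R]_n -> R[i], schwartz (on_prod Gamma0) ->
    (mixed_norm p q (fun t => abs_nabla alpha (fun x => propagator t Gamma0 x x))
     <= K%:E * sobolev_norm s (on_prod Gamma0))%E) ->
  (2%:E <= q)%E.
Proof.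
move=> n0 p1 q1 a0 s0 HK; case: q q1 HK => [r|_ _|//]; last exact: leey.
rewrite lee_fin => r1 HK; rewrite lee_fin leNgt; apply/negP => r2.
have r0 : 0 < r by rewrite (lt_le_trans ltr01).
have [delta [e [d0 e0 He]]] := @wide_packet_lower_bound R n alpha a0 n0.
have nR : 0 < n%:R :> R by rewrite ltr0n.
pose l := Num.sqrt (delta / n%:R).
have l0 : 0 < l by rewrite sqrtr_gt0 divr_gt0.
pose a := diag_cst n * fourier_cst n * e * (l ^+ n) `^ r^-1 * Lscale p 1.
have aa0 : 0 < a.
  rewrite mulr_gt0 ?Lscale_gt0// mulr_gt0 ?powR_gt0 ?exprn_gt0// mulr_gt0//.
  by rewrite mulr_gt0 ?diag_cst_gt0 ?fourier_cst_gt0.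
pose P : R := Num.sqrt pi ^+ n * Num.sqrt pi ^+ n.
have P0 : 0 <= P by rewrite mulr_ge0 ?exprn_ge0 ?sqrtr_ge0.
pose b := `|K| * Num.sqrt (sobolev_cst s (const_mx 1 : 'rV[R]_n) * P).
apply: (@powR_nat_unbounded R (n%:R * (r^-1 - 2^-1)) (b / a)).
  by rewrite mulr_gt0// subr_gt0 ltf_pV2 ?posrE.
move=> N N0; pose L : R := N%:R.
have L1 : 1 <= L by rewrite ler1n.
have L0 : 0 < L by rewrite ltr0n.
pose y := L ^+ n; have y0 : 0 < y by exact: exprn_gt0.
rewrite powRrM powR_mulrn ?ler0n// -/L -/y.
(* In terms of y = L^n, a density of size y^(-1) on a box of volume comparable to y has L^r norm at
   least of order y^(-1 + 1/r), while the Sobolev bound is of order y^(-1/2). *)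
have -> : r^-1 - 2^-1 = (-1 + r^-1) - (-1 * 2^-1) by lra.
apply: powR_cancel => //.
have lL0 : 0 < l * L by exact: mulr_gt0.
have m0 : 0 < (l * L) ^+ n by exact: exprn_gt0.
have eL0 : 0 <= e * L^-1 ^+ n by rewrite mulr_ge0 ?exprn_ge0 ?invr_ge0 ?(ltW e0) ?(ltW L0).
have mE : measurable (`[0, 1]%classic : set (measurableTypeR R)) by exact: measurable_itv.
have xB x : @box R n 0 (l * L) x -> dot x x <= delta * L ^+ 2.
  move=> /(dot_box_le (lexx 0) (ltW lL0)) /le_trans; apply.
  rewrite add0r exprMn sqr_sqrtr ?divr_ge0 ?(ltW d0) ?(ltW nR)// mulrA.
  by rewrite [n%:R * _]mulrC divfK ?gt_eqF.
have H := @packets_test n 1 p r%:E alpha s K (L ^+ 2) (fun=> 0) (const_mx 1) `[0, 1]%classic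
  (@box R n 0 (l * L)) (e * L^-1 ^+ n) 1 ((l * L) ^+ n) HK p1 _ a0 s0 (exprn_ege1 _ L1) mE
  (@measurable_box R n 0 (l * L)) eL0 ltr01 m0.
have {}H := H _ _ _ _.
have yV : L^-1 ^+ n = y `^ (-1) by rewrite exprVn powR_inv1// ltW.
have lhs : a * y `^ (-1 + r^-1) = diag_cst n * fourier_cst n * (e * L^-1 ^+ n) *
    Lscale r%:E ((l * L) ^+ n) * Lscale p 1.
  rewrite /= exprMn powRM ?exprn_ge0 ?(ltW l0) ?(ltW L0)// powRD ?(gt_eqF y0) ?implybT//.
  rewrite yV /a -/y; ring.
rewrite lhs; apply: le_trans (H _ _ _ _) _ => //.
- by rewrite [leRHS]lebesgue_measure_itv/= lte_fin ltr01 sube0.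
- by rewrite lebesgue_box// ltW.
- move=> t x; rewrite /= in_itv/= => /andP[t0 t1] /xB xd; apply: He => //.
  exact: exprn_ile1.
- rewrite !big_ord1 subrr expr0n/= mul0r addr0.
  have -> : Num.sqrt (pi / L ^+ 2) = Num.sqrt pi * L^-1.
    by rewrite sqrtrM ?pi_ge0// sqrtrV ?exprn_ge0 ?(ltW L0)// sqrtr_sqr ger0_norm// ltW.
  rewrite exprMn [X in sobolev_cst _ _ * X]mulrA -/P yV mulrA.
  rewrite sqrtrM ?mulr_ge0 ?sobolev_cst_ge0//.
  by rewrite powRrM powR12_sqrt ?powR_ge0// mulrA.
Qed.

End testing.
Theorem theorem1p2 (R : realType) (n : nat) (p q : \bar R) (alpha s : R) :
  (1 <= n)%N ->
  (1%:E <= p)%E -> (1%:E <= q)%E ->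
  0 <= alpha -> 0 <= s ->
  (exists K : R, forall Gamma0 : 'rV[R]_n -> 'rV[R]_n -> R[i],
    schwartz (on_prod Gamma0) ->
    (mixed_norm p q
       (fun t => abs_nabla alpha (fun x => propagator t Gamma0 x x))
     <= K%:E * sobolev_norm s (on_prod Gamma0))%E) ->
  (2%:E <= p)%E /\ (2%:E <= q)%E.
Proof.
move=> n1 p1 q1 a0 s0 [K HK]; split.
- exact: (time_exponent_ge2 n1 p1 q1 a0 s0 HK).
- exact: (space_exponent_ge2 n1 p1 q1 a0 s0 HK).
Qed.
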